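(* For every integer $h\geqslant 2$, there are only finitely many (up to isomorphism) integral trees with nullity $h$.
   Context: All graphs are finite and simple. The eigenvalues of a graph are the eigenvalues of its adjacency matrix. A graph is integral if all of its eigenvalues are integers. The nullity of a graph is the nullity of its adjacency matrix, i.e. the multiplicity of $0$ as an eigenvalue. *)

(* Defs.v *)
From Stdlib Require List.
From mathcomp Require Import all_boot all_order all_algebra all_field.

Set Implicit Arguments.
Unset Strict Implicit.
Unset Printing Implicit Defensive.

Import GRing.Theory Num.Theory.
Local Open Scope ring_scope.

Record sgraph := SGraph {
  vertex :> finType;
  adj : rel vertex;
  adj_sym : symmetric adj;
  adj_irrefl : irreflexive adj
}.

Arguments adj {s} : rename.

Definition isomorphic (G H : sgraph) : Prop :=
  exists2 f : G -> H, bijective f & forall x y : G, adj (f x) (f y) = adj x y.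

Definition connected_graph (G : sgraph) : Prop :=
  (0 < #|G|)%N /\ forall x y : G, connect adj x y.

(* The size bound excludes the closed walks x, y, x along a single edge,
   which [ucycle] accepts as the sequence [:: x; y]. *)
Definition acyclic (G : sgraph) : Prop :=
  forall c : seq G, (2 < size c)%N -> ~ ucycle adj c.

Definition is_tree (G : sgraph) : Prop := connected_graph G /\ acyclic G.

Definition adjmx (G : sgraph) : 'M[algC]_#|G| :=
  \matrix_(i < #|G|, j < #|G|) (adj (enum_val i) (enum_val j))%:R.

(* [eigenvalue] is taken over algC, where the characteristic polynomial
   splits, so this ranges over the whole spectrum. *)
Definition integral_graph (G : sgraph) : Prop :=
  forall a : algC, eigenvalue (adjmx G) a -> a \in Num.int.

Definition nullity (G : sgraph) : nat := \rank (kermx (adjmx G)).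

(* [sgraph] has no decidable equality, hence [List.In] and not [\in]. *)
Definition finitely_many_up_to_iso (P : sgraph -> Prop) : Prop :=
  exists s : seq sgraph,
    forall G : sgraph, P G -> exists2 H : sgraph, List.In H s & isomorphic G H.

(* Main.v *)
(* All test vectors are rational functions on the vertices.  As the spectrum
   consists of integers, <Af, f> <= |Af|^2 for every f.  Let D be the set of
   vertices at which some kernel vector of A does not vanish.  For a tree, D is
   independent, and the inequality forces every other vertex to have at least two
   neighbours in D.  Counting edges then shows that all but boundedly many
   vertices outside D have exactly two neighbours, both in D; the inequality
   again shows that these vertices are the subdivision points of stars.
   So the tree is a bounded core to which pendant paths of length 2 are
   attached, and only the numbers of these paths remain to be bounded.

   Let L be the largest eigenvalue, x its positive eigenvector and v the vertex
   carrying the most pendant paths, m of them, with d' further neighbours.  The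
   second largest eigenvalue is at most L - 1, hence every other vertex carries
   at most (L - 1)^2 pendant paths and, if L is large, x is concentrated near v.
   The eigenvalue equation at v then gives d' <= L^2 - 1 - m < d' + 1, with
   equality only for a subdivided star, whose nullity is 1. *)

Require Import Defs.
From mathcomp Require Import all_boot all_order all_algebra all_field.
From mathcomp Require Import spectral sesquilinear ring lra zify.

Set Implicit Arguments.
Unset Strict Implicit.
Unset Printing Implicit Defensive.

Import Order.TTheory GRing.Theory Num.Theory.
Local Open Scope ring_scope.

(** * The adjacency operator *)

Definition nbsum (R : pzRingType) (G : sgraph) (f : G -> R) (x : G) : R :=
  \sum_(y | adj x y) f y.

Definition dot (R : pzRingType) (G : sgraph) (f g : G -> R) : R :=
  \sum_x f x * g x.

Definition delta (R : pzRingType) (G : sgraph) (v x : G) : R := (x == v)%:R.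
Arguments delta R {G}.

Section Operators.
Variables (R : comPzRingType) (G : sgraph).
Implicit Types (f g : G -> R) (v x : G).

Lemma eq_nbsum f g : f =1 g -> nbsum f =1 nbsum g.
Proof. by move=> fg x; apply: eq_bigr => y _. Qed.

Lemma nbsumD f g x : nbsum (fun y => f y + g y) x = nbsum f x + nbsum g x.
Proof. exact: big_split. Qed.

Lemma nbsumZ c f x : nbsum (fun y => c * f y) x = c * nbsum f x.
Proof. by rewrite /nbsum -mulr_sumr. Qed.

Lemma nbsum_delta v x : nbsum (delta R v) x = (adj x v)%:R.
Proof.
rewrite /nbsum /delta; case axv: (adj x v).
  rewrite (bigD1 v) //= eqxx big1 ?addr0 // => y /andP[_ /negPf->] //.
by rewrite big1 // => y axy; case: eqP axy => // ->; rewrite axv.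
Qed.

Lemma eq_dot f f' g g' : f =1 f' -> g =1 g' -> dot f g = dot f' g'.
Proof. by move=> ff gg; apply: eq_bigr => x _; rewrite ff gg. Qed.

Lemma eq_dotl f f' g : f =1 f' -> dot f g = dot f' g.
Proof. by move=> ff; apply: eq_dot. Qed.

Lemma eq_dotr f g g' : g =1 g' -> dot f g = dot f g'.
Proof. exact: eq_dot. Qed.

Lemma dotC f g : dot f g = dot g f.
Proof. by apply: eq_bigr => x _; rewrite mulrC. Qed.

Lemma dotDl f f' g : dot (fun x => f x + f' x) g = dot f g + dot f' g.
Proof. by rewrite /dot -big_split; apply: eq_bigr => x _; rewrite mulrDl. Qed.

Lemma dotZl c f g : dot (fun x => c * f x) g = c * dot f g.
Proof. by rewrite /dot mulr_sumr; apply: eq_bigr => x _; rewrite mulrA. Qed.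

Lemma dotDr f g g' : dot f (fun x => g x + g' x) = dot f g + dot f g'.
Proof. by rewrite dotC dotDl !(dotC f). Qed.

Lemma dotZr c f g : dot f (fun x => c * g x) = c * dot f g.
Proof. by rewrite dotC dotZl dotC. Qed.

Lemma dot_delta v f : dot (delta R v) f = f v.
Proof.
rewrite /dot /delta (bigD1 v) //= eqxx mul1r big1 ?addr0 // => x /negPf->.
by rewrite mul0r.
Qed.

Lemma dot_nbsum f g : dot (nbsum f) g = dot f (nbsum g).
Proof.
rewrite /dot /nbsum; under eq_bigr do rewrite mulr_suml.
under [RHS]eq_bigr do rewrite mulr_sumr.
rewrite (exchange_big_dep xpredT) //=; apply: eq_bigr => x _.
by apply: eq_bigl => y; rewrite adj_sym.
Qed.

End Operators.

Lemma dot_ge0 (G : sgraph) (f : G -> rat) : 0 <= dot f f.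
Proof. by apply: sumr_ge0 => x _; rewrite -expr2 sqr_ge0. Qed.

Lemma dot_eq0 (G : sgraph) (f : G -> rat) : dot f f = 0 -> f =1 fun=> 0.
Proof.
move=> f0 x; apply/eqP; rewrite -sqrf_eq0 expr2.
by apply/eqP/(psumr_eq0P _ f0) => // y _; rewrite -expr2 sqr_ge0.
Qed.

Lemma nbsum_ratr (G : sgraph) (f : G -> rat) x :
  nbsum (fun y => ratr (f y) : algC) x = ratr (nbsum f x).
Proof. by rewrite /nbsum rmorph_sum. Qed.

(** * Functions on the vertices as row vectors, kernel and rank over the rationals *)

Section Matrices.
Variable G : sgraph.

Definition ratmx : 'M[rat]_#|G| :=
  \matrix_(i, j) (adj (enum_val i) (enum_val j))%:R.

Lemma map_ratmx : map_mx ratr ratmx = adjmx G.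
Proof. by apply/matrixP => i j; rewrite !mxE rmorph_nat. Qed.

Lemma trmx_ratmx : ratmx^T = ratmx.
Proof. by apply/matrixP => i j; rewrite !mxE adj_sym. Qed.

Definition rowf (R : pzRingType) (f : G -> R) : 'rV[R]_#|G| :=
  \row_i f (enum_val i).

Definition frow (R : pzRingType) (u : 'rV[R]_#|G|) (x : G) : R :=
  u 0 (enum_rank x).

Lemma frowK (R : pzRingType) (u : 'rV[R]_#|G|) : rowf (frow u) = u.
Proof. by apply/rowP => i; rewrite mxE /frow enum_valK. Qed.

Lemma rowfK (R : pzRingType) (f : G -> R) : frow (rowf f) =1 f.
Proof. by move=> x; rewrite /frow mxE enum_rankK. Qed.

Lemma rowf_eq0 (R : pzRingType) (f : G -> R) : rowf f = 0 <-> f =1 fun=> 0.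
Proof.
split=> [f0 x | f0]; first by rewrite -rowfK f0 /frow mxE.
by apply/rowP => i; rewrite !mxE.
Qed.

Lemma sum_enum_val (R : nmodType) (F : G -> R) :
  \sum_(i < #|G|) F (enum_val i) = \sum_x F x.
Proof.
rewrite [RHS](reindex (enum_val : 'I_#|G| -> G)) //=; exists enum_rank => x _;
  by rewrite ?enum_valK ?enum_rankK.
Qed.

Lemma mul_rowf (R : comPzRingType) (f : G -> R) :
  rowf f *m (\matrix_(i, j) (adj (enum_val i) (enum_val j))%:R) =
  rowf (nbsum f).
Proof.
apply/rowP => j; rewrite !mxE /nbsum.
pose F x := f x * (adj x (enum_val j))%:R.
rewrite (eq_bigr (fun i : 'I_#|G| => F (enum_val i))) => [|i _]; last first.
  by rewrite !mxE.
rewrite sum_enum_val [RHS]big_mkcond /=; apply: eq_bigr => x _.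
by rewrite /F adj_sym; case: adj; rewrite ?mulr1 ?mulr0.
Qed.

Lemma mul_rowf_ratmx (f : G -> rat) : rowf f *m ratmx = rowf (nbsum f).
Proof. exact: mul_rowf. Qed.

Lemma mul_rowf_adjmx (f : G -> algC) : rowf f *m adjmx G = rowf (nbsum f).
Proof. exact: mul_rowf. Qed.

Lemma rowf_kermx (f : G -> rat) :
  (rowf f <= kermx ratmx)%MS <-> nbsum f =1 fun=> 0.
Proof.
rewrite -rowf_eq0 -mul_rowf_ratmx.
by split=> [/sub_kermxP | ?]; last exact/sub_kermxP.
Qed.

Lemma nullityE : nullity G = \rank (kermx ratmx).
Proof. by rewrite /nullity -map_ratmx -map_kermx mxrank_map. Qed.

(** Vanishing at [v] is a single linear condition: [kermx c] is a hyperplane, and it meets a space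
    of dimension at least 2 nontrivially. *)
Lemma nullity_kernel_vanishing (v : G) : (2 <= nullity G)%N ->
  exists f : G -> rat, [/\ nbsum f =1 (fun=> 0), f v = 0 & exists x, f x != 0].
Proof.
rewrite nullityE => h2.
pose c : 'cV[rat]_#|G| := delta_mx (enum_rank v) 0.
have: (0 < \rank (kermx ratmx :&: kermx c))%N.
  have := mxrank_sum_cap (kermx ratmx) (kermx c).
  have := rank_leq_row (kermx ratmx + kermx c)%MS.
  have := rank_leq_row (kermx c); rewrite [\rank (kermx c)]mxrank_ker mxrank_delta.
  lia.
rewrite lt0n mxrank_eq0 => /rowV0Pn[u]; rewrite sub_capmx => /andP[uM uc] u0.
exists (frow u); split.
- by apply/rowf_kermx; rewrite frowK.
- move/sub_kermxP: uc => /matrixP/(_ 0 0); rewrite !mxE.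
  rewrite (bigD1 (enum_rank v)) //= mxE !eqxx mulr1 big1 ?addr0 // => j.
  by move=> /negPf jv; rewrite mxE jv mulr0.
- move/rV0Pn: u0 => [i ui]; exists (enum_val i).
  by rewrite /frow enum_valK.
Qed.

(** Fredholm alternative: by symmetry of [ratmx] the columns of its cokernel are kernel vectors, so
    orthogonality to the kernel puts [rowf g] in the row space. *)
Lemma range_of_orthogonal (g : G -> rat) :
  (forall k, nbsum k =1 (fun=> 0) -> dot g k = 0) ->
  exists w, nbsum w =1 g.
Proof.
move=> gk; suff /submxP[u Eu] : (rowf g <= ratmx)%MS.
  exists (frow u) => x.
  by rewrite -[RHS]rowfK Eu -{2}(frowK u) mul_rowf_ratmx rowfK.
rewrite submxE; apply/eqP/rowP => j; rewrite [RHS]mxE.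
pose k := frow (col j (cokermx ratmx))^T.
have /gk : nbsum k =1 (fun=> 0).
  apply/rowf_eq0; rewrite -mul_rowf_ratmx frowK -[X in _ *m X]trmx_ratmx -trmx_mul.
  by rewrite colE mulmxA mulmx_coker mul0mx trmx0.
rewrite /dot -sum_enum_val => gk0; rewrite mxE -[RHS]gk0.
by apply: eq_bigr => i _; rewrite /k /frow !mxE enum_valK.
Qed.

(** The quantifier over all kernel vectors becomes decidable on the spanning rows of [kermx ratmx]:
    all kernel vectors vanish at [v] exactly when the column of [v] is zero. *)
Fact kernel_support_exists : {D : {set G} | forall v,
  v \in D <-> exists2 k, nbsum k =1 (fun=> (0 : rat)) & k v != 0}.
Proof.
exists [set v | col (enum_rank v) (kermx ratmx) != 0] => v.
rewrite inE; split=> [/cV0Pn[i] | [k /rowf_kermx/submxP[u Eu] kv]].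
  rewrite mxE => kv; exists (frow (row i (kermx ratmx))).
    by apply/rowf_kermx; rewrite frowK row_sub.
  by rewrite /frow mxE.
apply: contra kv => /eqP c0; rewrite -rowfK Eu /frow mxE.
apply/eqP/big1 => i _.
by have /matrixP/(_ i 0) := c0; rewrite !mxE => ->; rewrite mulr0.
Qed.

Definition support_set : {set G} := sval kernel_support_exists.

Lemma support_setP (v : G) :
  v \in support_set <-> exists2 k, nbsum k =1 (fun=> (0 : rat)) & k v != 0.
Proof. exact: (svalP kernel_support_exists). Qed.

Lemma mxrank_sums_leq (n : nat) (I : finType) (P : pred I)
    (B : I -> 'M[rat]_n) : (forall i, \rank (B i) <= 1)%N ->
  (\rank (\sum_(i | P i) B i)%MS <= #|P|)%N.
Proof.
move=> B1; rewrite -sum1_card; elim: (index_enum I) => [|i r IH].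
  by rewrite !big_nil mxrank0.
rewrite !big_cons; have -> : (i \in P) = P i by []; case: (P i) => //.
by apply: leq_trans (mxrank_adds_leqif _ _) _; rewrite leq_add.
Qed.

(* A row indexed outside [S] is supported on [S], so the rows indexed by [S]
   and the unit vectors indexed by [S] together span the row space. *)
Lemma card_leq_vertex_cover_nullity (S : {set G}) :
  (forall x y, adj x y -> x \notin S -> y \in S) ->
  (#|G| <= 2 * #|S| + nullity G)%N.
Proof.
move=> cov; rewrite nullityE mxrank_ker.
pose I := [pred i : 'I_#|G| | enum_val i \in S].
have cI : #|I| = #|S|.
  rewrite -!sum1_card [RHS](reindex (enum_val : 'I_#|G| -> G)) //=.
  by exists enum_rank => x _; rewrite ?enum_valK ?enum_rankK.
pose U := (\sum_(i | I i) <<row i ratmx>>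
  + \sum_(i | I i) <<delta_mx 0 i : 'rV_#|G| >>)%MS.
have rU : (\rank U <= 2 * #|S|)%N.
  apply: leq_trans (mxrank_adds_leqif _ _) _; rewrite mul2n -addnn -cI.
  by apply: leq_add; apply: mxrank_sums_leq => i; rewrite genmxE rank_leq_row.
have MU : (ratmx <= U)%MS.
  apply/row_subP => i; case iS: (enum_val i \in S).
    apply: submx_trans (addsmxSl _ _).
    by apply: (sumsmx_sup i); rewrite ?genmxE.
  apply: submx_trans (addsmxSr _ _).
  rewrite [row i _]row_sum_delta; apply: summx_sub => j _.
  rewrite !mxE; case aij: (adj _ _); last by rewrite scale0r sub0mx.
  rewrite scale1r; apply: (sumsmx_sup j); last by rewrite genmxE.
  by rewrite inE /= (cov _ _ aij) ?iS.
by have := mxrankS MU; lia.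
Qed.

End Matrices.

(** * Integer spectrum *)

Section SpectralResolution.
Local Open Scope sesquilinear_scope.

Lemma spectral_resolution (G : sgraph) : integral_graph G ->
  exists (d : 'I_#|G| -> int) (e : 'I_#|G| -> G -> algC),
  [/\ forall i x, nbsum (e i) x = (d i)%:~R * e i x,
      forall i, exists x, e i x != 0
    & forall f g : G -> algC,
      \sum_x f x * (g x)^* = \sum_i dot f (e i) * (dot g (e i))^*].
Proof.
move=> intG; set A := adjmx G.
have Areal : A \is a mxOver Num.real.
  by apply/mxOverP => i j; rewrite mxE realn.
have Asym : A \is symmetricmx.
  apply/is_hermitianmxP; rewrite expr0 scale1r.
  by apply/matrixP => i j; rewrite !mxE adj_sym.
have /orthomx_spectralP := hermitian_normalmx (realsym_hermsym Asym Areal).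
set P := spectralmx A; set sp := spectral_diag A.
have Pu : P \is unitarymx := spectral_unitarymx A.
move=> EA.
have PA : P *m A = diag_mx sp *m P.
  by rewrite EA !mulmxA mulmxV ?unitarymx_unit // mul1mx.
have PP : P ^t* *m P = 1%:M.
  by rewrite -invmx_unitary // mulVmx // unitarymx_unit.
have rowA i : row i P *m A = sp 0 i *: row i P.
  by rewrite -row_mul PA row_mul row_diag_mx -scalemxAl -rowE.
have rowP0 i : row i P != 0.
  apply/negP => /eqP r0; have := unitarymxP Pu => /matrixP/(_ i i).
  rewrite !mxE eqxx big1 => [/eqP|j _]; first by rewrite eq_sym oner_eq0.
  by have /rowP/(_ j) := r0; rewrite !mxE => ->; rewrite mul0r.
have spint i : sp 0 i \in Num.int.
  by apply: intG; apply/eigenvalueP; exists (row i P).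
have exd i : {z : int | sp 0 i = z%:~R}.
  by exists (Num.floor (sp 0 i)); rewrite floorK ?spint.
(* As [dot] is bilinear, the conjugation is built into the eigenfunctions: [dot f (e i)] is then the
   hermitian coefficient of [f] along row [i] of [P]. *)
exists (fun i => sval (exd i)), (fun i x => (frow (row i P) x)^*).
split=> [i x|i|f g].
- case: (exd i) => z /= Ez.
  have : nbsum (frow (row i P)) x = sp 0 i * frow (row i P) x.
    rewrite -[LHS]rowfK -mul_rowf_adjmx frowK rowA /frow mxE //.
  move/(congr1 Num.conj); rewrite /nbsum rmorph_sum rmorphM /= => ->.
  by rewrite Ez; congr (_ * _); apply/CrealP; rewrite realz.
- have /rV0Pn[j Pj] := rowP0 i; exists (enum_val j).
  by rewrite fmorph_eq0 /frow enum_valK.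
- have c (h : G -> algC) i :
    dot h (fun x => (frow (row i P) x)^*) = (rowf h *m P ^t*) 0 i.
    rewrite /dot -sum_enum_val mxE; apply: eq_bigr => j _.
    by rewrite /frow !mxE enum_valK.
  transitivity ((rowf f *m (rowf g) ^t*) 0 0).
    by rewrite -sum_enum_val mxE; apply: eq_bigr => j _; rewrite !mxE.
  have -> : rowf f *m (rowf g) ^t* = rowf f *m P ^t* *m (rowf g *m P ^t*) ^t*.
    rewrite [in RHS]trmx_mul map_mxM /=.
    have -> : map_mx Num.conj (P ^t*)^T = P by rewrite -[RHS]trmxCK.
    by rewrite mulmxA -(mulmxA (rowf f)) PP mulmx1.
  rewrite [LHS]mxE; apply: eq_bigr => i _.
  rewrite !c; congr (_ * _).
  by rewrite [LHS]mxE [X in Num.conj X]mxE. 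
Qed.

End SpectralResolution.

Section SpectralConsequences.
Variables (G : sgraph) (d : 'I_#|G| -> int) (e : 'I_#|G| -> G -> algC).
Hypothesis eigen_e : forall i x, nbsum (e i) x = (d i)%:~R * e i x.
Hypothesis parseval : forall f g : G -> algC,
  \sum_x f x * (g x)^* = \sum_i dot f (e i) * (dot g (e i))^*.
Implicit Types f g : G -> rat.

Let coef f i : algC := dot (fun x => ratr (f x)) (e i).

Let weight f i : algC := `|coef f i| ^+ 2.

Lemma coef_nbsum f i : coef (nbsum f) i = (d i)%:~R * coef f i.
Proof.
rewrite /coef (@eq_dot _ _ _ (nbsum (fun x => ratr (f x))) _ (e i)) //.
  by rewrite dot_nbsum -dotZr; apply: eq_bigr => x _; rewrite eigen_e.
by move=> x; rewrite nbsum_ratr.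
Qed.

Lemma ratr_dot f g : ratr (dot f g) = \sum_i coef f i * (coef g i)^*.
Proof.
rewrite -parseval rmorph_sum; apply: eq_bigr => x _.
by rewrite rmorphM /= (CrealP _) // Creal_Crat // Crat_rat.
Qed.

Lemma weight_ge0 f i : 0 <= weight f i.
Proof. exact: exprn_ge0. Qed.

Lemma ratr_dot_self f : ratr (dot f f) = \sum_i weight f i.
Proof. by rewrite ratr_dot; apply: eq_bigr => i _; rewrite /weight normCK. Qed.

Lemma ratr_dot_nbsum f :
  ratr (dot (nbsum f) f) = \sum_i (d i)%:~R * weight f i.
Proof.
rewrite ratr_dot; apply: eq_bigr => i _.
by rewrite coef_nbsum /weight normCK mulrA.
Qed.

Lemma ratr_dot_nbsum2 f :
  ratr (dot (nbsum f) (nbsum f)) = \sum_i (d i * d i)%:~R * weight f i.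
Proof.
rewrite ratr_dot; apply: eq_bigr => i _.
rewrite !coef_nbsum /weight normCK rmorphM /= rmorph_int intrM; ring.
Qed.

(** Every integer [n] satisfies [n <= n * n]; this is summed over the eigenvalues with the weights
    of [f]. *)
Lemma energy_le f : dot (nbsum f) f <= dot (nbsum f) (nbsum f).
Proof.
rewrite -(ler_rat algC) ratr_dot_nbsum ratr_dot_nbsum2; apply: ler_sum => i _.
by rewrite ler_wpM2r ?weight_ge0 // ler_int; nia.
Qed.

(** The alternative [weight f i = 0] covers an [f] orthogonal to the eigenvectors above [L], as in
    the spectral gap of [perron]. *)
Lemma rayleigh_le (L : int) f : (forall i, weight f i = 0 \/ d i <= L) ->
  dot (nbsum f) f <= L%:~R * dot f f.
Proof.
move=> dL; rewrite -(ler_rat algC) rmorphM /= ratr_dot_nbsum ratr_dot_self.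
rewrite ratr_int mulr_sumr; apply: ler_sum => i _.
have [->|le_dL] := dL i; first by rewrite !mulr0.
by rewrite ler_wpM2r ?weight_ge0 // ler_int.
Qed.

(** The defect in the Rayleigh bound is the sum of the nonnegative terms [(L - d i) * weight f i].
    If it vanishes, each term does, and so does every coefficient of [nbsum f - L f]. *)
Lemma rayleigh_eq (L : int) f : (forall i, d i <= L) ->
  L%:~R * dot f f <= dot (nbsum f) f -> forall x, nbsum f x = L%:~R * f x.
Proof.
move=> dL Lf.
have Ef : dot (nbsum f) f = L%:~R * dot f f.
  by apply/eqP; rewrite eq_le Lf rayleigh_le // => i; right.
have w0 i : (L - d i)%:~R * weight f i = 0.
  apply: (@psumr_eq0P _ _ xpredT (fun i => (L - d i)%:~R * weight f i)) => //.
    by move=> j _; rewrite mulr_ge0 ?weight_ge0 // ler0z subr_ge0.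
  transitivity (ratr (L%:~R * dot f f - dot (nbsum f) f) : algC).
    rewrite rmorphB rmorphM /= ratr_dot_nbsum ratr_dot_self ratr_int mulr_sumr.
    by rewrite -sumrB; apply: eq_bigr => j _; rewrite -mulrBl -intrB.
  by rewrite Ef subrr rmorph0.
pose g x := nbsum f x - L%:~R * f x.
suff g0 : dot g g = 0.
  by move=> x; apply/eqP; rewrite -subr_eq0; apply/eqP/(dot_eq0 g0).
apply: (fmorph_inj (ratr : {rmorphism rat -> algC})).
rewrite rmorph0 [LHS]ratr_dot_self.
apply: big1 => i _; rewrite /weight.
have -> : coef g i = (d i - L)%:~R * coef f i.
  rewrite intrB mulrBl -coef_nbsum /coef /dot mulr_sumr -sumrB.
  apply: eq_bigr => x _.
  rewrite /g rmorphB rmorphM /= ratr_int mulrBl; congr (_ - _).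
  exact: esym (mulrA _ _ _).
have /eqP := w0 i; rewrite mulf_eq0 => /orP[/eqP dL0|/eqP w00].
  by rewrite -opprB intrN dL0 oppr0 mul0r normr0 expr0n.
by rewrite normrM exprMn -/(weight f i) w00 mulr0.
Qed.

End SpectralConsequences.

Lemma integral_energy_le (G : sgraph) (f : G -> rat) : integral_graph G ->
  dot (nbsum f) f <= dot (nbsum f) (nbsum f).
Proof. by case/spectral_resolution=> d [e [ed _ pars]]; apply: energy_le pars f. Qed.

Lemma connected_closed_all (G : sgraph) (Z : pred G) (v : G) :
  connected_graph G -> Z v -> (forall x y, Z x -> adj x y -> Z y) ->
  forall x, Z x.
Proof.
move=> [_ conG] Zv ZS x; have /connectP[p pp ->] := conG v x.
by elim: p v pp Zv => //= y p IH v /andP[vy pp] Zv; apply: IH pp (ZS _ _ Zv vy).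
Qed.

(** At a zero of [f] the eigenvalue equation is a vanishing sum of nonnegative values, so zeros
    spread along the edges. *)
Lemma connected_nonneg_eigenvector_eq0 (G : sgraph) (R : numFieldType)
    (f : G -> R) (L : R) :
  connected_graph G -> (forall x, 0 <= f x) ->
  (forall x, nbsum f x = L * f x) -> forall v, f v = 0 -> forall x, f x = 0.
Proof.
move=> conG f0 Ef v fv x; apply/eqP.
apply: (@connected_closed_all _ (fun x => f x == 0) v) => //; first exact/eqP.
move=> {x}x y /eqP fx axy; apply/eqP.
by apply: (psumr_eq0P _ (_ : nbsum f x = 0)) => //; rewrite Ef fx mulr0.
Qed.

(** [L] is the largest eigenvalue. The absolute value of an eigenvector for [L] attains the maximal
    Rayleigh quotient as well, hence is an eigenvector, positive by connectedness. The gap holds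
    because the eigenvalues are integers and [L] is simple. *)
Lemma perron (G : sgraph) : connected_graph G -> integral_graph G ->
  exists (L : int) (x : G -> rat),
  [/\ forall v, 0 < x v,
      forall v, nbsum x v = L%:~R * x v
    & forall f, dot f x = 0 -> dot (nbsum f) f <= (L - 1)%:~R * dot f f].
Proof.
move=> conG /spectral_resolution[d [e [ed en0 pars]]].
have [card0 _] := conG.
pose i0 : 'I_#|G| := Ordinal card0.
pose im := [arg max_(i > i0) d i]%O; pose L := d im.
have dL i : d i <= L.
  by rewrite /L /im; case: Order.TotalTheory.arg_maxP => // j _; apply.
have [y0 [yne yeig]] : exists y : G -> rat,
    (exists x, y x != 0) /\ (forall x, nbsum y x = L%:~R * y x).
  (* [L] is rational, so as an eigenvalue of a rational matrix it has a rational eigenvector. *)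
  have : eigenvalue (adjmx G) (ratr L%:~R).
    apply/eigenvalueP; exists (rowf (e im)).
      by rewrite mul_rowf_adjmx; apply/rowP => j; rewrite !mxE ed ratr_int.
    have [x ex] := en0 im; apply: contra ex => /eqP/rowf_eq0 ->.
    exact: eqxx.
  rewrite -map_ratmx eigenvalue_map => /eigenvalueP[u Eu u0].
  exists (frow u); split.
    by have /rV0Pn[j uj] := u0; exists (enum_val j); rewrite /frow enum_valK.
  by move=> x; rewrite -[LHS]rowfK -mul_rowf_ratmx frowK Eu /frow mxE.
pose x v := `|y0 v|.
have xeig : forall v, nbsum x v = L%:~R * x v.
  apply: (rayleigh_eq ed pars) => //.
  have -> : dot x x = dot y0 y0.
    by apply: eq_bigr => v _; rewrite /x -normrM ger0_norm // -expr2 sqr_ge0.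
  rewrite -dotZl; apply: ler_sum => v _; rewrite -yeig /x.
  apply: le_trans (ler_norm _) _; rewrite normrM ler_wpM2r //.
  exact: ler_norm_sum.
have xpos v : 0 < x v.
  rewrite lt_def /x normr_ge0 andbT; apply/negP => /eqP xv0.
  have [w /negP[]] := yne; rewrite -normr_eq0; apply/eqP.
  exact: (connected_nonneg_eigenvector_eq0 conG (fun v => normr_ge0 (y0 v)) xeig xv0).
exists L, x; split=> // f fx; apply: (rayleigh_le ed pars) => i.
have [dl|] := ltP (d i) L; first by right; lia.
move=> Ld; left; have {Ld} di : d i = L by apply/eqP; rewrite eq_le dL Ld.
have [_ conn] := conG.
pose v0 := enum_val i0; pose c : algC := e i v0 / ratr (x v0).
(* Simplicity of [L]: [r] is an eigenvector made to vanish at [v0]. The function [nbsum |r| - L |r|]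
   is nonnegative and orthogonal to the positive [x], hence zero; so [|r|] is an eigenvector with a
   zero, and [r = 0]. *)
pose r v := e i v - c * ratr (x v).
have reig v : nbsum r v = L%:~R * r v.
  rewrite /nbsum sumrB -mulr_sumr -/(nbsum (e i) v) ed di.
  rewrite -/(nbsum (fun y => ratr (x y)) v) nbsum_ratr xeig /r rmorphM /=.
  rewrite ratr_int; ring.
have rn : forall v, nbsum (fun y => `|r y|) v = L%:~R * `|r v|.
  have ge v : 0 <= nbsum (fun y => `|r y|) v - L%:~R * `|r v|.
    rewrite subr_ge0; apply: le_trans (_ : `|L%:~R * r v| <= _).
      by rewrite normrM ler_wpM2r // real_ler_norm // realz.
    by rewrite -reig; apply: ler_norm_sum.
  have : \sum_v ratr (x v) * (nbsum (fun y => `|r y|) v - L%:~R * `|r v|) = 0.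
    under eq_bigr do rewrite mulrBr; rewrite sumrB.
    rewrite -/(dot (fun v => ratr (x v)) (nbsum (fun y => `|r y|))) -dot_nbsum.
    rewrite -sumrB big1 // => v _; rewrite nbsum_ratr xeig rmorphM /= ratr_int.
    ring.
  move=> s0 v; apply/eqP; rewrite -subr_eq0; apply/eqP.
  have xC w : 0 <= ratr (x w) :> algC by rewrite ler0q ltW.
  have /eqP := psumr_eq0P (fun v _ => mulr_ge0 (xC v) (ge v)) s0 (erefl : xpredT v).
  by rewrite mulf_eq0 fmorph_eq0 gt_eqF ?xpos //= => /eqP.
have r0 v : r v = 0.
  apply/eqP; rewrite -normr_eq0; apply/eqP.
  apply: (connected_nonneg_eigenvector_eq0 conG _ rn (v := v0)) => //.
  by rewrite /r /c mulfVK ?subrr ?normr0 // fmorph_eq0 gt_eqF.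
rewrite (_ : dot _ _ = 0) ?normr0 ?expr0n //.
transitivity (c * ratr (dot f x)); last by rewrite fx rmorph0 mulr0.
rewrite /dot rmorph_sum mulr_sumr; apply: eq_bigr => v _.
have /eqP := r0 v; rewrite /r subr_eq0 => /eqP ->; rewrite rmorphM /=; ring.
Qed.

(** * Growing a tree leaf by leaf *)

Definition induced (G : sgraph) (S : {set G}) : rel G :=
  [rel x y | [&& adj x y, x \in S & y \in S]].

(** Two distinct neighbours of [x] in [S], joined by a simple path inside [S], would close a cycle
    through [x]. *)
Lemma acyclic_unique_neighbour (G : sgraph) (S : {set G}) (x y z : G) :
  acyclic G -> {in S &, forall a b, connect (induced S) a b} ->
  x \notin S -> y \in S -> z \in S -> adj x y -> adj x z -> z = y.
Proof.
move=> acG conS xS yS zS axy axz; apply/eqP; apply: contraT => zy.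
have /connectP[p0 pp0 lp0] := conS y z yS zS.
move: lp0; case/shortenP: pp0 => p pp up _ zE.
have pS : all (mem S) p.
  elim: p y {yS axy zy zE up} pp => //= a p IH y /andP[/and3P[_ _ aS] pp].
  by rewrite aS /=; apply: IH pp.
have padj : path adj y p.
  by apply: sub_path pp => a b /and3P[].
case: (acG (x :: y :: p)).
  by case: p zE {pp up pS padj} => //= zE; rewrite zE eqxx in zy.
apply/andP; split.
  by rewrite /= axy rcons_path padj -zE adj_sym axz.
rewrite /= in up *; rewrite up andbT inE negb_or.
rewrite (contraNneq _ xS) => [|->] //=.
by apply: contra xS => /(allP pS).
Qed.

Lemma connected_boundary_edge (G : sgraph) (S : {set G}) (r : G) :
  connected_graph G -> r \in S -> S != setT ->
  exists x y, [/\ x \notin S, y \in S & adj x y].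
Proof.
move=> conG rS ST.
case: (pickP [pred p : G * G | [&& p.1 \notin S, p.2 \in S & adj p.1 p.2]]).
  by case=> x y /and3P[]; exists x, y.
move=> no; case/negP: ST; apply/eqP/setP => x; rewrite in_setT.
apply: (@connected_closed_all _ (fun x => x \in S) r) => // {x}x y xS axy.
by apply: contraFT (no (y, x)) => yS /=; rewrite yS xS adj_sym axy.
Qed.

(** A connected set is grown from a root: connectedness of the tree supplies a boundary edge, and
    acyclicity makes each added vertex a leaf of the enlarged set. *)
Lemma tree_growth_ind (G : sgraph) (P : {set G} -> Prop) :
  is_tree G -> (forall r, P [set r]) ->
  (forall (S : {set G}) x y, P S -> x \notin S -> y \in S -> adj x y ->
    (forall z, z \in S -> adj x z -> z = y) -> P (x |: S)) ->
  P setT.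
Proof.
move=> [conG acG] P1 PS; have [/card_gt0P[r _] _] := conG.
pose Q (S : {set G}) := [/\ r \in S, P S
  & {in S &, forall a b, connect (induced S) a b}].
suff H n : forall S, Q S -> (#|~: S| <= n)%N -> P setT.
  apply: (H _ [set r]) (leqnn _); split; rewrite ?set11 //.
  by move=> a b /set1P-> /set1P->; apply: connect0.
elim: n => [|n IH] S [rS PP conS].
  rewrite leqn0 cards_eq0 => /eqP SC.
  by rewrite -(setCK S) SC setC0 in PP.
move=> cS; have [<-|/(connected_boundary_edge conG rS)] := eqVneq S setT => //.
move=> [x [y [xS yS axy]]].
have uniq_y z : z \in S -> adj x z -> z = y.
  by move=> zS; apply: acyclic_unique_neighbour acG conS xS yS zS axy.
apply: (IH (x |: S)); last first.
  rewrite -ltnS; apply: leq_trans cS; apply: proper_card.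
  rewrite properE !setCS subsetUr; apply/subsetPn; exists x => //.
  by rewrite setU11.
split; first by rewrite !inE rS orbT.
  exact: (PS _ _ _ PP xS yS axy uniq_y).
have sym : connect_sym (induced (x |: S)).
  apply: sym_connect_sym => a b.
  by rewrite /induced /= adj_sym; case: (adj b a) => /=; rewrite /= 1?andbC.
have cy a : a \in x |: S -> connect (induced (x |: S)) a y.
  case/setU1P => [->|aS].
    by apply: connect1; rewrite /induced /= axy setU11 !inE yS orbT.
  apply: connect_sub (conS a y aS yS) => b c /and3P[abc bS cS'].
  by apply: connect1; rewrite /induced /= abc !inE bS cS' !orbT.
by move=> a b aS bS; apply: connect_trans (cy _ aS) _; rewrite sym cy.
Qed.

Lemma tree_bipartition (G : sgraph) : is_tree G ->
  exists s : G -> bool, forall x y, adj x y -> s x != s y.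
Proof.
move=> treeG.
suff [s Hs] : exists s : G -> bool,
  {in setT &, forall x y, adj x y -> s x != s y}.
  by exists s => x y; apply: Hs; rewrite in_setT.
apply: (tree_growth_ind (P := fun S : {set G} => exists s : G -> bool,
  {in S &, forall x y, adj x y -> s x != s y}) treeG).
  by move=> r; exists xpredT => x y /set1P-> /set1P->; rewrite adj_irrefl.
move=> S x y [s Hs] xS yS axy uy.
(* The new leaf gets the colour opposite to that of its only neighbour. *)
exists (fun z => if z == x then ~~ s y else s z) => a b.
have neq c : c \in S -> (c == x) = false.
  by move=> cS; apply: contraNF xS => /eqP<-.
case/setU1P => [->|aS] /setU1P[->|bS]; first by rewrite adj_irrefl.
- by rewrite eqxx neq // => /(uy _ bS) ->; case: (s y).
- by rewrite eqxx neq // adj_sym => /(uy _ aS) ->; case: (s y).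
- by rewrite !neq //; apply: Hs.
Qed.

(** Deleting the edge [u v] disconnects the tree, and [S] is the side of [v]. *)
Lemma tree_edge_cut (G : sgraph) (u v : G) : is_tree G -> adj u v ->
  exists S : {set G}, [/\ u \notin S, v \in S
    & forall x y, adj x y -> x \in S -> y \notin S -> x = v /\ y = u].
Proof.
move=> treeG.
suff H : {in setT &, forall u v, adj u v -> exists S : {set G},
    [/\ u \notin S, v \in S & forall x y, x \in setT -> y \in setT -> adj x y ->
       x \in S -> y \notin S -> x = v /\ y = u]}.
  move=> auv; have [|| S [uS vS HS]] := H u v _ _ auv; rewrite ?in_setT //.
  by exists S; split=> // x y; apply: HS; rewrite in_setT.
apply: (tree_growth_ind (P := fun T : {set G} =>
  {in T &, forall u v, adj u v -> exists S : {set G},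
    [/\ u \notin S, v \in S & forall x y, x \in T -> y \in T -> adj x y ->
       x \in S -> y \notin S -> x = v /\ y = u]}) treeG).
  by move=> r a b /set1P-> /set1P->; rewrite adj_irrefl.
move=> T x y IH xT yT axy uy a b; have neq c : c \in T -> c != x.
  by move=> cT; apply: contraNneq xT => <-.
case/setU1P => [->|aT] /setU1P[->|bT]; first by rewrite adj_irrefl.
- move=> /(uy _ bT) ->; exists T; split=> // p q.
  case/setU1P => [->|pT]; first by move=> _ _ xT'; rewrite xT' in xT.
  case/setU1P => [->|qT]; last by move=> _ _; rewrite qT.
  by rewrite adj_sym => /(uy _ pT) ->.
- rewrite adj_sym => /(uy _ aT) ->; exists [set x]; split; rewrite ?set11 //.
    by rewrite inE neq.
  move=> p q _ /setU1P[->|qT]; first by move=> _ _; rewrite set11.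
  by move=> apq /set1P px _; subst p; split => //; apply: uy.
move=> /(IH _ _ aT bT)[S [aS bS HS]].
(* The leaf [x] goes to the side of its neighbour [y]. The inductive [S] is arbitrary outside [T],
   so [x] may have to be removed from it. *)
exists (if y \in S then x |: S else S :\ x); case: ifP => yS.
- split; rewrite ?inE ?bS ?orbT ?negb_or ?neq //.
  move=> p q; case/setU1P => [->|pT] /setU1P[->|qT] apq.
  + by rewrite adj_irrefl in apq.
  + by rewrite (uy _ qT apq) !inE yS orbT.
  + by rewrite !inE eqxx.
  + by rewrite !inE !(negPf (neq _ _)) //=; apply: HS.
- split; rewrite ?inE ?bS ?negb_and ?negbK ?aS ?neq ?orbT //.
  move=> p q; case/setU1P => [->|pT] /setU1P[->|qT] apq.
  + by rewrite adj_irrefl in apq.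
  + by rewrite !inE eqxx.
  + by move: apq; rewrite adj_sym => /(uy _ pT) ->; rewrite !inE yS andbF.
  + by rewrite !inE !(neq _ _) //=; apply: HS.
Qed.

(** The vertex of [U] that is added last in the growth of the tree has at most one neighbour among
    the earlier ones. *)
Lemma tree_subset_leaf (G : sgraph) (U : {set G}) : is_tree G -> U != set0 ->
  exists2 x, x \in U & {in U &, forall y z, adj x y -> adj x z -> y = z}.
Proof.
move=> treeG; have := subsetT U; move: U.
apply: (tree_growth_ind (P := fun T : {set G} => forall U : {set G},
  U \subset T -> U != set0 ->
  exists2 x, x \in U & {in U &, forall y z, adj x y -> adj x z -> y = z})) => //.
  move=> r U /subsetP Ur /set0Pn[x xU]; exists x => // y z /Ur/set1P-> /Ur/set1P->.
  by move=> _ _.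
move=> S x y IH xS yS axy uy U US U0; case xU: (x \in U).
  exists x => // a b aU bU axa axb.
  have inS c : c \in U -> adj x c -> c \in S.
    move=> cU axc; have /setU1P[cx|//] := subsetP US _ cU.
    by rewrite cx adj_irrefl in axc.
  by rewrite (uy a (inS _ aU axa) axa) (uy b (inS _ bU axb) axb).
apply: IH => //; apply/subsetP => a aU.
by have /setU1P[ax|//] := subsetP US _ aU; rewrite -ax aU in xU.
Qed.

Lemma tree_degree_sum (G : sgraph) : is_tree G ->
  (\sum_(x : G) \sum_(y : G) adj x y = 2 * #|G|.-1)%N.
Proof.
move=> treeG.
suff : (\sum_(x in [set: G]) \sum_(y in [set: G]) adj x y = 2 * #|[set: G]|.-1)%N.
  rewrite cardsT => <-; apply: eq_big => [x|x _]; first by rewrite in_setT.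
  by apply: eq_bigl => y; rewrite in_setT.
apply: (tree_growth_ind (P := fun T : {set G} =>
  (\sum_(x in T) \sum_(y in T) adj x y = 2 * #|T|.-1)%N)) => //.
  by move=> r; rewrite cards1 !big_set1 adj_irrefl.
move=> S x y IH xS yS axy uy.
rewrite cardsU1 xS /= big_setU1 //= big_setU1 //= adj_irrefl add0n.
have -> : (\sum_(j in S) adj x j = 1)%N.
  rewrite (bigD1 y) //= axy big1 // => z /andP[zS zy].
  by case axz: (adj x z) => //; rewrite (uy z zS axz) eqxx in zy.
under eq_bigr => i iS do rewrite big_setU1 //=.
rewrite big_split /= IH.
have -> : (\sum_(i in S) adj i x = 1)%N.
  rewrite (bigD1 y) //= adj_sym axy big1 // => z /andP[zS zy].
  by rewrite adj_sym; case axz: (adj x z) => //; rewrite (uy z zS axz) eqxx in zy.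
have : (0 < #|S|)%N by apply/card_gt0P; exists y.
lia.
Qed.

(** Such an [f] minimises the nonnegative quadratic form [|nbsum f|^2 - <nbsum f, f>], so its
    derivative at [f] vanishes; in the direction [r] that derivative is [2 * dot r r]. *)
Lemma integral_energy_eq (G : sgraph) (f : G -> rat) : integral_graph G ->
  dot (nbsum f) f = dot (nbsum f) (nbsum f) ->
  nbsum (nbsum f) =1 nbsum f.
Proof.
move=> intG Ef; pose r x := nbsum (nbsum f) x + (-1) * nbsum f x.
suff r0 : dot r r = 0.
  by move=> x; have := dot_eq0 r0 x; rewrite /r; lra.
have Er : dot r r = dot (nbsum f) (nbsum r) - dot (nbsum f) r.
  by rewrite {1}/r dotDl dotZl dot_nbsum; ring.
clearbody r.
pose q := dot (nbsum r) (nbsum r) - dot (nbsum r) r.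
have q0 : 0 <= q by rewrite subr_ge0 integral_energy_le.
have Q t : 0 <= 2 * t * dot r r + t ^+ 2 * q.
  pose g x := f x + t * r x.
  have Eg : nbsum g =1 fun x => nbsum f x + t * nbsum r x.
    by move=> x; rewrite /g nbsumD nbsumZ.
  have := integral_energy_le g intG; rewrite -subr_ge0 !(eq_dotl _ Eg) (eq_dotr _ Eg).
  rewrite !(dotDl, dotDr, dotZl, dotZr) (dotC (nbsum r) (nbsum f)).
  rewrite (dot_nbsum r f) (dotC r (nbsum f)) Er /q Ef.
  by move/le_trans; apply; lra.
have := dot_ge0 r; rewrite le_eqVlt => /orP[/eqP <- //|r0].
(* A small negative [t] makes the linear term dominate; [q + 1] replaces [q] because [q] may be
   zero. *)
have := Q (- (dot r r / (q + 1))).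
have q1 : q + 1 != 0 by lra.
rewrite (_ : _ + _ = - (dot r r ^+ 2 * (q + 2) / (q + 1) ^+ 2)); last by field.
rewrite oppr_ge0 leNgt divr_gt0 //; first by rewrite mulr_gt0 ?exprn_gt0 //; lra.
by rewrite exprn_gt0 //; lra.
Qed.

Definition nbrs (G : sgraph) (x : G) : {set G} := [set y | adj x y].

Lemma in_nbrs (G : sgraph) (x y : G) : (y \in nbrs x) = adj x y.
Proof. by rewrite inE. Qed.

(** * The support of the kernel *)

Section KernelSupport.
Variable G : sgraph.
Hypothesis treeG : is_tree G.
Implicit Types (k w f g : G -> rat) (u v x y : G).
Local Notation D := (support_set G).

Lemma kernel_off_support k x :
  nbsum k =1 (fun=> 0) -> x \notin D -> k x = 0.
Proof.
move=> k0; apply: contraNeq => kx.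
by apply/support_setP; exists k.
Qed.

(* The witness is [k] restricted to the side of [v] of the edge [u v]. *)
Lemma cut_kernel k u v : adj u v -> nbsum k =1 (fun=> 0) -> k u = 0 ->
  exists2 w, nbsum w =1 (fun x => k v * delta rat u x)
    & forall x, k x = 0 -> w x = 0.
Proof.
move=> auv k0 ku; have [S [uS vS cutS]] := tree_edge_cut treeG auv.
exists (fun x => if x \in S then k x else 0); last by move=> x ->; case: ifP.
move=> x; rewrite /nbsum -big_mkcondr /delta /=; case xS: (x \in S).
  have -> : x == u = false by apply: contraNF uS => /eqP <-.
  rewrite mulr0 -[RHS](k0 x) /nbsum [RHS](bigID (mem S)) /=.
  rewrite [X in _ = _ + X]big1 ?addr0 // => y /andP[axy yS].
  by have [_ ->] := cutS _ _ axy xS yS.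
have cutx y : adj x y && (y \in S) -> y = v /\ x = u.
  by case/andP=> axy yS; apply: cutS; rewrite ?xS // adj_sym.
have [xu|xu] := eqVneq x u.
  rewrite mulr1 (bigD1 v) /=; last by rewrite xu auv vS.
  by rewrite big1 ?addr0 // => y /andP[/cutx[->]]; rewrite eqxx.
by rewrite mulr0 big1 // => y /cutx[_ xu']; rewrite xu' eqxx in xu.
Qed.

(** The adjacency operator exchanges the colour classes: the values of [w] on class [b] affect
    [nbsum w] only outside that class, where [g] vanishes, so they can be replaced by zero. *)
Lemma range_class (s : G -> bool) (b : bool) w g :
  (forall x y, adj x y -> s x != s y) ->
  nbsum w =1 g -> (forall x, s x != b -> g x = 0) ->
  exists2 w', nbsum w' =1 g & forall x, s x = b -> w' x = 0.
Proof.
move=> bip Ew gb; exists (fun x => if s x == b then 0 else w x); last first.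
  by move=> x ->; rewrite eqxx.
move=> x; have [sx|sx] := eqVneq (s x) b.
  rewrite -Ew; apply: eq_bigr => y /bip; rewrite sx eq_sym.
  by move/negPf => ->.
rewrite gb // [LHS]big1 // => y /bip; rewrite eq_sym => /negPf sxy.
by move: sx sxy; case: b {gb}; case: (s y); case: (s x).
Qed.

(** Let [k] and [k'] be kernel vectors nonzero at [u] and [v]. Restricted to the colour class of
    [v], [k'] stays in the kernel and vanishes at [u], so [cut_kernel] puts a nonzero multiple of
    [delta u] in the range; but the range is orthogonal to [k]. *)
Lemma support_independent u v : adj u v -> u \in D -> v \notin D.
Proof.
move=> auv /support_setP[k k0 ku]; apply/negP => /support_setP[k' k'0 k'v].
have [s bip] := tree_bipartition treeG.
pose kv x := if s x == s v then k' x else 0.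
have kv0 : nbsum kv =1 (fun=> 0).
  move=> x; have [sx|sx] := eqVneq (s x) (s v).
    apply: big1 => y /bip; rewrite /kv sx eq_sym; by move/negPf => ->.
  rewrite -[RHS](k'0 x); apply: eq_bigr => y /bip; rewrite /kv.
  by move: sx; case: (s x); case: (s y); case: (s v).
have kvu : kv u = 0 by rewrite /kv (negPf (bip _ _ auv)).
have [w Ew _] := cut_kernel auv kv0 kvu.
have : dot k (nbsum w) = 0.
  by rewrite -dot_nbsum /dot big1 // => x _; rewrite k0 mul0r.
rewrite (eq_dotr _ Ew) dotZr dotC dot_delta => /eqP.
by rewrite mulf_eq0 (negPf ku) /kv eqxx (negPf k'v).
Qed.

Lemma delta_preimage a u : a \notin D -> u \in D -> adj a u ->
  exists2 w, nbsum w =1 delta rat a & forall x, x \notin D -> w x = 0.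
Proof.
move=> aD /support_setP[k k0 ku] aau.
have [w Ew w0] := cut_kernel aau k0 (kernel_off_support k0 aD).
exists (fun x => (k u)^-1 * w x) => x.
  by rewrite nbsumZ Ew mulKf.
by move=> xD; rewrite w0 ?mulr0 // (kernel_off_support k0).
Qed.

(** With [t] the preimage of [delta a] supported on [D], self-adjointness gives
    [w a = <nbsum t, w> = <t, g>], and [t] and [g] have disjoint supports. *)
Lemma preimage_support w g a u : nbsum w =1 g ->
  (forall x, x \in D -> g x = 0) -> a \notin D -> u \in D -> adj a u -> w a = 0.
Proof.
move=> Ew gD aD uD aau; have [t Et t0] := delta_preimage aD uD aau.
rewrite -dot_delta -(eq_dotl _ Et) dot_nbsum (eq_dotr _ Ew).
apply: big1 => x _; have [xD|xD] := boolP (x \in D).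
  by rewrite gD ?mulr0.
by rewrite t0 ?mul0r.
Qed.

Lemma range_off_support g : (forall x, x \in D -> g x = 0) ->
  exists w, nbsum w =1 g.
Proof.
move=> gD; apply: range_of_orthogonal => k k0; apply: big1 => x _.
have [xD|xD] := boolP (x \in D); first by rewrite gD ?mul0r.
by rewrite (kernel_off_support k0) ?mulr0.
Qed.

(** In the kernel equation at [a], the nonzero value at [u] has to be cancelled by another
    neighbour. *)
Lemma support_second_neighbour a u : u \in D -> adj a u ->
  exists2 u', u' != u & (u' \in D) && adj a u'.
Proof.
move=> /support_setP[k k0 ku] aau.
case: (pickP [pred y | [&& adj a y, y != u & k y != 0]]) => [y|no].
  case/and3P=> aay yu ky; exists y => //; rewrite aay andbT.
  by apply/support_setP; exists k.
case/negP: ku; rewrite -(k0 a) /nbsum (bigD1 u) //= big1 ?addr0 // => y.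
by case/andP=> aay yu; apply/eqP; have := no y; rewrite /= aay yu; case: eqP.
Qed.

(** * Integrality forces every vertex outside the support to have a neighbour in it *)

Hypothesis intG : integral_graph G.
Hypothesis nul2 : (2 <= nullity G)%N.

Lemma support_neq0 : exists u, u \in D.
Proof.
have [[/card_gt0P[v _] _] _] := treeG.
have [k [k0 _ [x kx]]] := nullity_kernel_vanishing v nul2.
by exists x; apply/support_setP; exists k.
Qed.

(** The vertices not dominated by [D]; [support_dominating] shows that there are none. *)
Let C := [set c | (c \notin D) && [forall u in D, ~~ adj c u]].

Lemma C_off_support c : c \in C -> c \notin D.
Proof. by rewrite inE => /andP[]. Qed.

Lemma C_nbr c x : c \in C -> adj c x -> x \notin D.
Proof.
rewrite inE => /andP[_ /forallP/(_ x)] /implyP cx acx.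
by apply/negP => /cx; rewrite acx.
Qed.

Lemma preimage_off_C w g x : nbsum w =1 g ->
  (forall x, x \in D -> g x = 0) -> x \notin D -> x \notin C -> w x = 0.
Proof.
move=> Ew gD xD; rewrite inE xD /= negb_forall => /existsP[u].
rewrite negb_imply negbK => /andP[uD axu].
exact: preimage_support Ew gD xD uD axu.
Qed.

Lemma delta_C_off_support c x : c \in C -> x \in D -> delta rat c x = 0.
Proof.
move=> /C_off_support cD xD; rewrite /delta; case: eqP => // xc.
by rewrite -xc xD in cD.
Qed.

(** Let [w0] and [w1] be the preimages of [delta c'] and [delta c]. The equation at [c'] gives
    [w0 c = 1], and symmetry gives [w1 c' = 1]. So [f = w0 + w1] has equality in the energy bound,
    both sides being 2, and [delta c' + delta c] is an eigenvector for 1: no edge leaves the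
    pair. *)
Lemma C_component c c' : c \in C -> c' \in C -> adj c' c ->
  {in C, forall x, adj c' x -> x = c} ->
  forall x, adj x c || adj x c' -> (x == c) || (x == c').
Proof.
move=> cC c'C acc leaf; have [s bip] := tree_bipartition treeG.
have pre b : b \in C -> exists2 w, nbsum w =1 delta rat b
    & forall x, s x = s b -> w x = 0.
  move=> bC; have [w Ew] := range_off_support (fun x => @delta_C_off_support b x bC).
  apply: range_class bip Ew _ => x sx; rewrite /delta.
  by have [xb|//] := eqVneq x b; rewrite xb eqxx in sx.
have [w0 E0 s0] := pre _ c'C; have [w1 E1 s1] := pre _ cC.
have w0C x : x \notin D -> x \notin C -> w0 x = 0.
  exact: preimage_off_C E0 (fun x => @delta_C_off_support _ x c'C).
have w0c : w0 c = 1.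
  have := E0 c'; rewrite /delta eqxx /nbsum (bigD1 c) //= big1 ?addr0 //.
  move=> x /andP[acx xc]; apply: w0C; first exact: C_nbr acx.
  by apply: contra xc => xC; apply/eqP/leaf.
pose f x := w0 x + w1 x.
have Ef : nbsum f =1 fun x => delta rat c' x + delta rat c x.
  by move=> x; rewrite /f nbsumD E0 E1.
have cc : c != c' by apply: contraTneq acc => ->; rewrite adj_irrefl.
have d01 : delta rat c' c = 0 by rewrite /delta (negPf cc).
have d10 : delta rat c c' = 0 by rewrite /delta eq_sym (negPf cc).
have d11 b : delta rat b b = 1 by rewrite /delta eqxx.
have /(integral_energy_eq intG) : dot (nbsum f) f = dot (nbsum f) (nbsum f).
  rewrite !(eq_dotl _ Ef) (eq_dotr _ Ef) !(dotDl, dotDr) !dot_delta.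
  rewrite d01 d10 !d11 w0c s0 // (s1 c) //.
  rewrite -(dot_delta c') -(eq_dotl _ E0) dot_nbsum.
  by rewrite (eq_dotr _ E1) dotC dot_delta w0c; ring.
move=> EE x.
have := EE x; rewrite (eq_nbsum Ef) Ef nbsumD !nbsum_delta /delta.
by case: (adj x c); case: (adj x c'); case: (x == c); case: (x == c').
Qed.

(** Otherwise take a leaf [c'] of the forest on [C]. A preimage of [delta c'] vanishes at its
    neighbours outside [C], so [c'] has a neighbour in [C]; by [C_component] these two vertices are
    the whole tree, although [D] is nonempty. *)
Lemma support_dominating x : x \notin D -> exists2 u, u \in D & adj x u.
Proof.
move=> xD; have [xC|] := boolP (x \in C); last first.
  rewrite inE xD /= negb_forall => /existsP[u].
  by rewrite negb_imply negbK => /andP[uD axu]; exists u.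
have : C != set0 by apply/set0Pn; exists x.
case/(tree_subset_leaf treeG) => c' c'C leaf.
have c'D y := @delta_C_off_support _ y c'C.
have [w Ew] := range_off_support c'D.
have [c cC acc] : exists2 c, c \in C & adj c' c.
  case: (pickP [pred y | adj c' y & y \in C]) => [c /andP[acc cC]|no].
    by exists c.
  have := Ew c'; rewrite /delta eqxx /nbsum big1 // => y acy.
  apply: (preimage_off_C Ew c'D); first exact: C_nbr acy.
  by apply: contraFN (no y) => yC /=; rewrite acy.
have comp := C_component cC c'C acc (fun y yC acy => leaf y c yC cC acy acc).
have [u uD] := support_neq0.
have [conG _] := treeG.
have : (u == c) || (u == c').
  apply: (@connected_closed_all _ (fun u => (u == c) || (u == c')) c conG).
    by rewrite eqxx.
  move=> a b /orP[]/eqP -> ab; apply: comp; first by rewrite adj_sym ab.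
  by rewrite (adj_sym b c') ab orbT.
by case/orP=> /eqP uc; rewrite uc in uD;
  [move/C_off_support: cC | move/C_off_support: c'C]; rewrite uD.
Qed.

(* Testing the energy inequality on [z + u] with [nbsum u = z]. *)
Lemma norm_le_nbsum (z : G -> rat) : (forall x, x \in D -> z x = 0) ->
  (forall x y, z x != 0 -> adj x y -> y \in D) ->
  dot z z <= dot (nbsum z) (nbsum z).
Proof.
move=> zD znbr; have [u Eu] := range_off_support zD.
have u0 x : x \notin D -> u x = 0.
  by move=> xD; have [v vD axv] := support_dominating xD;
    apply: preimage_support Eu zD xD vD axv.
have zu : dot z u = 0.
  apply: big1 => x _; have [xD|xD] := boolP (x \in D).
    by rewrite zD ?mul0r.
  by rewrite u0 ?mulr0.
have zz : dot (nbsum z) z = 0.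
  apply: big1 => x _; have [->|zx] := eqVneq (z x) 0; first by rewrite mulr0.
  by rewrite [nbsum z x]big1 ?mul0r // => y axy; rewrite zD // (znbr x).
pose f x := z x + u x.
have Ef : nbsum f =1 fun x => nbsum z x + z x.
  by move=> x; rewrite /f nbsumD Eu.
have := integral_energy_le f intG.
rewrite !(eq_dotl _ Ef) (eq_dotr _ Ef) !(dotDl, dotDr) (dotC z (nbsum z)) zz zu.
have -> : dot (nbsum z) u = dot z z by rewrite dot_nbsum (eq_dotr _ Eu).
lra.
Qed.

(** * Counting edges: bad and good vertices outside the support *)

Definition degD x := #|nbrs x :&: D|.
Definition degA x := #|nbrs x :\: D|.

Lemma degD_ge2 a : a \notin D -> (2 <= degD a)%N.
Proof.
move=> aD; have [u uD aau] := support_dominating aD.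
have [u' u'u /andP[u'D aau']] := support_second_neighbour uD aau.
apply: leq_trans (_ : #|[set u; u']| <= _)%N; first by rewrite cards2 eq_sym u'u.
by apply/subset_leq_card/subsetP => y /set2P[]->; rewrite !inE ?aau ?aau' ?uD ?u'D.
Qed.

Lemma deg_split x : #|nbrs x| = (degD x + degA x)%N.
Proof. by rewrite -(cardsID D). Qed.

Lemma nbrs_support u : u \in D -> nbrs u :&: D = set0.
Proof.
move=> uD; apply/setP => y; rewrite !inE; apply/negP => /andP[auy].
exact/negP/(support_independent auy).
Qed.

Lemma sum_degree : (\sum_(x : G) #|nbrs x| = 2 * #|G|.-1)%N.
Proof.
rewrite -(tree_degree_sum treeG); apply: eq_bigr => x _.
rewrite -sum1_card big_mkcond; apply: eq_bigr => y _.
by rewrite in_nbrs; case: adj.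
Qed.

Lemma card_support_complement : (#|G| <= 2 * #|~: D| + nullity G)%N.
Proof.
apply: card_leq_vertex_cover_nullity => x y axy.
by rewrite !in_setC negbK => xD; apply: support_independent axy xD.
Qed.

(** As [D] is independent, the degree sum [2 * (#|G| - 1)] equals the sum of [2 * degD a + degA a]
    over the complement of [D], a vertex cover, so that [#|G| <= 2 * #|~: D| + nullity G]. The
    subtraction is exact by [degD_ge2]. *)
Lemma sum_excess :
  (\sum_(a in ~: D) (2 * (degD a - 2) + degA a) + 2 <= 2 * nullity G)%N.
Proof.
have sD : (\sum_(u in D) #|nbrs u| = \sum_(a in ~: D) degD a)%N.
  transitivity (\sum_(u in D) \sum_(a in ~: D) (adj a u : nat))%N.
    apply: eq_bigr => u uD; rewrite deg_split /degD nbrs_support // cards0 add0n.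
    rewrite /degA -sum1_card big_mkcond [RHS]big_mkcond; apply: eq_bigr => y _.
    by rewrite !inE adj_sym; case: (y \in _); case: adj.
  rewrite exchange_big; apply: eq_bigr => a _.
  rewrite /degD -sum1_card big_mkcond [RHS]big_mkcond; apply: eq_bigr => y _.
  by rewrite !inE; case: (y \in _); case: adj.
have := sum_degree; rewrite (bigID (mem D)) /= sD.
have <- : (\sum_(a in ~: D) #|nbrs a| = \sum_(a | a \notin D) #|nbrs a|)%N.
  by apply: eq_bigl => a; rewrite in_setC.
have -> : (\sum_(a in ~: D) #|nbrs a| =
  \sum_(a in ~: D) degD a + \sum_(a in ~: D) degA a)%N.
  by rewrite -big_split; apply: eq_bigr => a _; apply: deg_split.
move=> E.
have E2 : (\sum_(a in ~: D) (2 * (degD a - 2) + degA a) + 4 * #|~: D| =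
  2 * (\sum_(a in ~: D) degD a) + \sum_(a in ~: D) degA a)%N.
  rewrite -sum1_card !big_distrr -!big_split /=; apply: eq_bigr => a.
  by rewrite in_setC => /degD_ge2; lia.
have := card_support_complement; have [[G0 _] _] := treeG; move: E E2 G0.
move: (\sum_(a in ~: D) degD a)%N (\sum_(a in ~: D) degA a)%N 
  (\sum_(a in ~: D) _)%N #|~: D| #|G| (nullity G); lia.
Qed.

Lemma excess_le a : a \notin D ->
  (2 * (degD a - 2) + degA a + 2 <= 2 * nullity G)%N.
Proof.
move=> aD; apply: leq_trans sum_excess; rewrite leq_add2r.
by rewrite (bigD1 a) ?in_setC //= leq_addr.
Qed.

Lemma deg_le a : a \notin D -> (#|nbrs a| <= 2 * nullity G + 2)%N.
Proof.
by move=> aD; have := excess_le aD; have := degD_ge2 aD; rewrite deg_split; lia.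
Qed.

(** The vertices with a nonzero term in [sum_excess]; the others outside [D] are the good ones. *)
Definition bad : {set G} := [set a in ~: D | ~~ ((degD a == 2) && (degA a == 0))%N].

Lemma card_bad : (#|bad| <= 2 * nullity G)%N.
Proof.
apply: leq_trans sum_excess; rewrite -sum1_card.
apply: leq_trans (leq_addr _ _); rewrite big_mkcond [leqRHS]big_mkcond.
apply: leq_sum => a _; rewrite inE in_setC; case aD: (a \in D) => //=.
have : (2 <= degD a)%N by rewrite degD_ge2 ?aD.
by case E: (_ && _) => //=; move: E; move: (degD a) (degA a); lia.
Qed.

Lemma good_nbrs a : a \notin D -> a \notin bad ->
  #|nbrs a| = 2 /\ (forall y, adj a y -> y \in D).
Proof.
move=> aD; rewrite inE in_setC aD /= negbK => /andP[/eqP dD /eqP dA].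
split; first by rewrite deg_split dD dA.
move=> y aay; apply: contraT => yD; move/eqP: dA; rewrite cards_eq0.
by move=> /eqP/setP/(_ y); rewrite in_setD in_nbrs yD aay in_set0.
Qed.

Lemma good_other a d : a \notin D -> a \notin bad -> adj a d ->
  exists d', [/\ d' != d, adj a d', d' \in D
    & forall y, adj a y -> y = d \/ y = d'].
Proof.
move=> aD ab aad; have [/eqP/cards2P[p [q [pq E]]] nD] := good_nbrs aD ab.
have Ey y : adj a y = (y == p) || (y == q) by rewrite -in_nbrs E !inE.
move: aad; rewrite Ey => /orP[]/eqP ->; [exists q | exists p].
- split; rewrite 1?eq_sym // ?Ey ?eqxx ?orbT //.
    by apply: nD; rewrite Ey eqxx orbT.
  by move=> y; rewrite Ey => /orP[]/eqP ->; [left | right].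
- split; rewrite // ?Ey ?eqxx //.
    by apply: nD; rewrite Ey eqxx.
  by move=> y; rewrite Ey => /orP[]/eqP ->; [right | left].
Qed.

Lemma support_adj_off a d : adj a d -> d \in D -> a \notin D.
Proof. by rewrite adj_sym; apply: support_independent. Qed.

(* Good vertices are the edges of a forest on [D]; three consecutive edges are
   excluded by the test vector [1, -1, 1], so its components are stars. *)
Lemma good_no_path3 a1 a2 a3 d1 d2 :
  a1 \notin bad -> a2 \notin bad -> a3 \notin bad ->
  d1 \in D -> d2 \in D -> d1 != d2 -> a1 != a2 -> a2 != a3 ->
  adj a1 d1 -> adj a2 d1 -> adj a2 d2 -> adj a3 d2 -> False.
Proof.
move=> b1 b2 b3 D1 D2 d12 a12 a23 a1d1 a2d1 a2d2 a3d2.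
have [_ acG] := treeG.
have n1 := support_adj_off a1d1 D1; have n2 := support_adj_off a2d1 D1.
have n3 := support_adj_off a3d2 D2.
have neq a d : a \notin D -> d \in D -> (a == d = false) * (d == a = false).
  by move=> aD dD; rewrite (eq_sym d); case: eqP aD => // ->; rewrite dD.
have cyc4 a b p q : p \in D -> q \in D -> a != b -> p != q ->
  adj a p -> adj b p -> adj b q -> adj a q -> False.
  move=> pD qD ab pq ap bp bq aq.
  have aD := support_adj_off ap pD; have bD := support_adj_off bp pD.
  apply: (acG [:: a; p; b; q]) => //; apply/andP; split.
    by rewrite /= ap (adj_sym p) bp bq (adj_sym q) aq.
  by rewrite /= !inE (negPf ab) (negPf pq) !(neq _ _ aD pD, neq _ _ aD qD,
    neq _ _ bD pD, neq _ _ bD qD).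
have a13 : a1 != a3.
  apply/eqP => E; subst a3; exact: (cyc4 a1 a2 d1 d2).
(* A common neighbour of [a1] and [a3] closes a cycle of length 4 if it is [d1] or [d2], and of
   length 6 otherwise. *)
have c13 d : adj a1 d -> adj a3 d -> False.
  move=> a1d a3d; have [_ /(_ d a1d) dD] := good_nbrs n1 b1.
  have [E|dd1] := eqVneq d d1.
    by subst d; apply: (cyc4 a3 a2 d1 d2); rewrite // eq_sym.
  have [E|dd2] := eqVneq d d2.
    by subst d; apply: (cyc4 a1 a2 d1 d2).
  apply: (acG [:: a1; d1; a2; d2; a3; d]) => //; apply/andP; split.
    by rewrite /= a1d1 (adj_sym d1) a2d1 a2d2 (adj_sym d2) a3d2 a3d adj_sym a1d.
  rewrite /= !inE (negPf a12) (negPf a13) (negPf a23) (negPf d12).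
  by rewrite !(eq_sym _ d) (negPf dd1) (negPf dd2)
    !(neq _ _ n1 D1, neq _ _ n1 D2, neq _ _ n1 dD, neq _ _ n2 D1, neq _ _ n2 D2,
      neq _ _ n2 dD, neq _ _ n3 D1, neq _ _ n3 D2, neq _ _ n3 dD).
pose z x := delta rat a1 x + (-1) * delta rat a2 x + delta rat a3 x.
have z1 : dot z z = 3.
  rewrite /z !(dotDl, dotDr, dotZl, dotZr, dot_delta) /delta !eqxx.
  rewrite !(eq_sym a2 a1) !(eq_sym a3 a1) !(eq_sym a3 a2).
  by rewrite (negPf a12) (negPf a13) (negPf a23).
have zE x : z x != 0 -> [|| x == a1, x == a2 | x == a3].
  by rewrite /z /delta; do 3!case: (x == _).
have := @norm_le_nbsum z.
have Ez : nbsum z =1 fun x => (adj x a1)%:R + (-1) * (adj x a2)%:R + (adj x a3)%:R.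
  by move=> x; rewrite /z !nbsumD nbsumZ !nbsum_delta.
rewrite z1 (eq_dotl _ Ez) (eq_dotr _ Ez) !(dotDl, dotDr, dotZl, dotZr).
have self a : a \notin D -> a \notin bad ->
  dot (fun x => (adj x a)%:R) (fun x => (adj x a)%:R) = 2 :> rat.
  move=> aD ab; have [c2 _] := good_nbrs aD ab.
  have -> : (2 : rat) = #|nbrs a|%:R by rewrite c2.
  rewrite -sum1_card natr_sum [RHS]big_mkcond; apply: eq_bigr => x _.
  by rewrite in_nbrs adj_sym; case: adj; rewrite ?mulr1 ?mulr0.
have ge1 a b d : adj a d -> adj b d ->
  1 <= dot (fun x => (adj x a)%:R) (fun x => (adj x b)%:R) :> rat.
  move=> ad bd; rewrite /dot (bigD1 d) //= !(adj_sym d) ad bd mulr1.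
  by rewrite lerDl sumr_ge0 // => x _; rewrite mulr_ge0.
have c0 : dot (fun x => (adj x a1)%:R) (fun x => (adj x a3)%:R) = 0 :> rat.
  apply: big1 => x _; case x1: (adj x a1); last by rewrite mul0r.
  case x3: (adj x a3); last by rewrite mulr0.
  by case: (c13 x); rewrite adj_sym.
have g12 := ge1 _ _ _ a1d1 a2d1; have g23 := ge1 _ _ _ a2d2 a3d2.
rewrite !(dotC (fun x => (adj x a2)%:R) (fun x => (adj x a1)%:R)).
rewrite !(dotC (fun x => (adj x a3)%:R) (fun x => (adj x a1)%:R)).
rewrite !(dotC (fun x => (adj x a3)%:R) (fun x => (adj x a2)%:R)).
(* [|z|^2 = 3], while [|nbsum z|^2] is 6 minus twice the overlaps at [d1] and [d2], hence at most
   2. *)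
rewrite !self // c0 => H; suff: 3 <= 2 :> rat by [].
have := H _ _; move=> {}H; apply: le_trans (H _ _) _; last by lra.
- move=> x xD; apply/eqP; apply: contraT => /zE.
  by rewrite !(neq _ x) ?neq //= => /or3P[]/eqP E;
    rewrite E (negPf n1, negPf n2, negPf n3) in xD.
- by move=> x y /zE/or3P[]/eqP -> xy; [have [_] := good_nbrs n1 b1
   | have [_] := good_nbrs n2 b2 | have [_] := good_nbrs n3 b3]; apply.
Qed.

(** In a subdivided star a kernel vector vanishing at the centre [d] is zero: the middle vertices
    lie outside [D], and the equations at them kill the ends. Nullity at least 2 supplies a nonzero
    one. *)
Lemma not_subdivided_star d : d \in D ->
  (forall a, adj d a -> exists d', [/\ d' != d, adj a d',
     forall y, adj a y -> y = d \/ y = d' & forall y, adj d' y -> y = a]) ->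
  False.
Proof.
move=> dD star.
have [k [k0 kd [x /negP[]]]] := nullity_kernel_vanishing d nul2.
pose Z x := (x == d) || [exists a, adj d a && ((x == a) || adj a x)].
have : Z x.
  have [conG _] := treeG.
  apply: (connected_closed_all (v := d) conG); first by rewrite /Z eqxx.
  move=> {}x y /orP[/eqP-> dy|/existsP[a /andP[da /orP[/eqP->|ax]]] xy].
  - by apply/orP; right; apply/existsP; exists y; rewrite dy eqxx.
  - by apply/orP; right; apply/existsP; exists a; rewrite da xy orbT.
  have [d' [_ _ Na Nd']] := star a da.
  have [E|E] := Na x ax; subst x.
    by apply/orP; right; apply/existsP; exists y; rewrite xy eqxx.
  by apply/orP; right; apply/existsP; exists a; rewrite da (Nd' y xy) eqxx.
have ka a : adj d a -> k a = 0.
  move=> da; apply: kernel_off_support => //.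
  exact: support_independent da dD.
case/orP=> [/eqP->|/existsP[a /andP[da /orP[/eqP->|ax]]]]; apply/eqP => //.
  exact: ka.
have [d' [d'd ad' Na _]] := star a da.
have [->|->] := Na x ax => //.
have := k0 a; rewrite /nbsum (bigD1 d') //= big1 ?addr0 // => y /andP[ay yd'].
by have [->|E] := Na y ay => //; rewrite E eqxx in yd'.
Qed.

(** * Pendant paths of length 2 and the bounded core *)

Definition leaf x := #|nbrs x| == 1%N.

Lemma leaf_nbr d a : leaf d -> adj d a -> forall y, adj d y -> y = a.
Proof.
move=> /cards1P[b E] da y dy.
by move: dy da; rewrite -!in_nbrs E => /set1P-> /set1P->.
Qed.

(* [pend] consists of the middle vertices of the pendant paths of length 2, and
   [rim] is [D] without the end vertices of these paths. *)
Definition pend : {set G} :=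
  [set a in ~: D | (a \notin bad) && [exists d, adj a d && leaf d]].

Definition core : {set G} := ~: D :\: pend.

Definition rim : {set G} :=
  [set d in D | ~~ (leaf d && [exists a in pend, adj d a])].

Lemma pendP a : a \in pend ->
  [/\ a \notin D, a \notin bad & exists2 d, adj a d & leaf d].
Proof.
rewrite inE in_setC => /and3P[aD ab /existsP[d /andP[ad ld]]].
by split=> //; exists d.
Qed.

Lemma rim_support d : d \in rim -> d \in D.
Proof. by rewrite inE => /andP[]. Qed.

Lemma rim_nonleaf d a : d \in rim -> a \in pend -> adj d a -> ~~ leaf d.
Proof.
rewrite inE => /andP[_]; rewrite negb_and => /orP[//|].
rewrite negb_exists => /forallP/(_ a); rewrite negb_and.
by move=> /orP[/negPf->|/negPf->].
Qed.

Lemma pend_rim d a : d \in rim -> a \in pend -> adj d a ->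
  exists d', [/\ d' != d, adj a d', d' \in D,
     forall y, adj a y -> y = d \/ y = d' & leaf d'].
Proof.
move=> dR aP da; have [aD ab [l al ll]] := pendP aP.
have ad : adj a d by rewrite adj_sym.
have [d' [d'd ad' d'D Na]] := good_other aD ab ad.
exists d'; split=> //; have [E|<- //] := Na _ al.
by have := rim_nonleaf dR aP da; rewrite -E ll.
Qed.

(** If all neighbours of [d] were in [pend], the tree would be a subdivided star centred at [d]. *)
Lemma rim_core d : d \in rim -> exists2 a, a \in core & adj d a.
Proof.
move=> dR; case: (pickP [pred a | adj d a & a \in core]) => [a /andP[da aC]|no].
  by exists a.
exfalso; apply: (not_subdivided_star (rim_support dR)) => a da.
have aP : a \in pend.
  have aD := support_independent da (rim_support dR).
  by apply: contraFT (no a) => aP /=; rewrite da in_setD aP in_setC aD.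
have [d' [d'd ad' d'D Na ld']] := pend_rim dR aP da.
exists d'; split=> //; apply: leaf_nbr => //.
by rewrite adj_sym.
Qed.

(** If both neighbours of [a] were leaves, the tree would be a path on three vertices, a subdivided
    star centred at an end. *)
Lemma pend_adj_rim a : a \in pend -> exists2 d, d \in rim & adj a d.
Proof.
move=> aP; have [aD ab [l al ll]] := pendP aP.
have [d [dl ad dD Na]] := good_other aD ab al.
exists d => //; rewrite inE dD /=; apply/negP => /andP[ld _].
have [_ /(_ l al) lD] := good_nbrs aD ab.
apply: (not_subdivided_star lD) => a'.
move=> /(leaf_nbr ll (_ : adj l a)) -> //; last by rewrite adj_sym.
by exists d; split=> //; apply: leaf_nbr; rewrite // adj_sym.
Qed.

Lemma rim_neq0 : rim != set0.
Proof.
have [d dD] := support_neq0; have [dR|] := boolP (d \in rim).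
  by apply/set0Pn; exists d.
rewrite inE dD negbK => /andP[_ /existsP[a /andP[aP _]]].
by have [r rR _] := pend_adj_rim aP; apply/set0Pn; exists r.
Qed.

Lemma card_covered (S U : {set G}) (m : nat) :
  (forall y, y \in S -> exists2 x, x \in U & adj x y) ->
  (forall x, x \in U -> #|nbrs x| <= m)%N -> (#|S| <= #|U| * m)%N.
Proof.
move=> cov degU; rewrite -[#|U|]sum1_card big_distrl /=.
apply: leq_trans (_ : \sum_(x in U) #|nbrs x| <= _)%N; last first.
  by apply: leq_sum => x /degU; rewrite mul1n.
rewrite -sum1_card.
apply: leq_trans (_ : \sum_(y in S) \sum_(x in U) (adj x y : nat) <= _)%N.
  apply: leq_sum => y /cov[x xU xy].
  by rewrite (bigD1 x) //= xy.
rewrite exchange_big /=; apply: leq_sum => x _.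
rewrite -sum1_card big_mkcond [leqRHS]big_mkcond; apply: leq_sum => y _.
by rewrite in_nbrs; case: (y \in S); case: adj.
Qed.

(* [hooked a d] determines [a] from the neighbour [d] of a bad vertex, which
   bounds the number of good vertices of [core]. *)
Definition hooked (a d : G) : bool :=
  [&& adj a d, [exists b in bad, adj b d]
    & [forall a', adj a' d && (a' \notin bad) ==> (a' == a)]].

Lemma nonleaf_other_nbr d a : adj d a -> ~~ leaf d ->
  exists2 b, b != a & adj d b.
Proof.
move=> da ld; case: (pickP [pred b | b != a & adj d b]) => [b /andP[ba db]|no].
  by exists b.
case/negP: ld; apply/cards1P; exists a; apply/setP => y; rewrite in_nbrs in_set1.
apply/idP/eqP => [dy|-> //]; apply/eqP.
by apply: contraFT (no y) => /= ->.
Qed.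

(** Neither neighbour of [a] is a leaf. If neither is hooked, each has a further good neighbour, and
    these together with [a] form the configuration excluded by [good_no_path3]. *)
Lemma core_hooked a : a \in core -> a \notin bad -> exists d, hooked a d.
Proof.
rewrite in_setD in_setC => /andP[aP aD] ab.
have nl d : adj a d -> ~~ leaf d.
  move=> ad; apply: contra aP => ld; rewrite inE in_setC aD ab /=.
  by apply/existsP; exists d; rewrite ad.
have [p pD ap] := support_dominating aD.
have [q [qp aq qD _]] := good_other aD ab ap.
have alt d : adj a d ->
    hooked a d \/ exists a', [/\ a' != a, a' \notin bad & adj a' d].
  move=> ad; case: (pickP [pred a' | [&& a' != a, a' \notin bad & adj a' d]]).
    by move=> a' /and3P[]; right; exists a'.
  move=> no; left; rewrite /hooked ad /=; apply/andP; split.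
    have da : adj d a by rewrite adj_sym.
    have [b ba db] := nonleaf_other_nbr da (nl _ ad).
    apply/existsP; exists b; rewrite adj_sym db andbT.
    by apply: contraFT (no b) => /= bb; rewrite ba bb adj_sym db.
  apply/forallP => a'; apply/implyP => /andP[a'd a'b].
  by apply: contraFT (no a') => /= ->; rewrite a'd a'b.
have [|[a1 [a1a b1 a1p]]] := alt p ap; first by exists p.
have [|[a3 [a3a b3 a3q]]] := alt q aq; first by exists q.
exfalso; apply: (@good_no_path3 a1 a a3 p q) => //; first by rewrite eq_sym.
by rewrite eq_sym.
Qed.

Lemma card_core :
  (#|core| <= 2 * nullity G + 2 * nullity G * (2 * nullity G + 2))%N.
Proof.
set h := nullity G; pose X := [set d | [exists b in bad, adj b d]].
have cX : (#|X| <= 2 * h * (2 * h + 2))%N.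
  apply: leq_trans (_ : #|bad| * (2 * h + 2) <= _)%N; last first.
    by rewrite leq_mul2r card_bad orbT.
  apply: card_covered => [d|b].
    by rewrite inE => /existsP[b /andP[bb bd]]; exists b.
  by rewrite inE in_setC => /andP[bD _]; apply: deg_le.
rewrite -(cardsID bad); apply: leq_add.
  by apply: leq_trans (subset_leq_card (subsetIr _ _)) card_bad.
(* By [core_hooked] the default is never taken on [core :\: bad], and there [g] is injective with
   values in [X]. *)
apply: leq_trans cX; pose g a := odflt a [pick d | hooked a d].
have gP a : a \in core :\: bad -> hooked a (g a).
  rewrite in_setD => /andP[ab aC]; rewrite /g; case: pickP => // no.
  by have [d] := core_hooked aC ab; rewrite no.
rewrite -(@card_in_imset _ _ g (mem (core :\: bad))) => [|a a' aN a'N gg].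
  apply/subset_leq_card/subsetP => d /imsetP[a /gP/and3P[_ ex _] ->].
  by rewrite inE.
have /and3P[_ _ /forallP/(_ a')/implyP] := gP _ aN.
have /and3P[a'd _ _] := gP _ a'N; rewrite gg a'd /=.
by move: a'N; rewrite in_setD => /andP[-> _] /(_ isT)/eqP ->.
Qed.

Lemma core_off_support a : a \in core -> a \notin D.
Proof. by rewrite in_setD in_setC => /andP[]. Qed.

Lemma core_nbr a y : a \in core -> adj a y -> y \in rim \/ y \in core.
Proof.
move=> aC ay; have aD := core_off_support aC.
have aP : a \notin pend by move: aC; rewrite in_setD => /andP[].
have [yD|yD] := boolP (y \in D); [left | right].
  rewrite inE yD /=; apply/negP => /andP[ly /existsP[b /andP[bP yb]]].
  have ya : adj y a by rewrite adj_sym.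
  by rewrite (leaf_nbr ly ya yb) (negPf aP) in bP.
rewrite in_setD in_setC yD andbT; apply/negP => /pendP[_ yb _].
have [_ /(_ a)] := good_nbrs yD yb; rewrite adj_sym ay => /(_ isT).
by rewrite (negPf aD).
Qed.

Lemma bad_degree a : a \in bad -> (2 < #|nbrs a|)%N.
Proof.
rewrite in_set in_setC deg_split => /andP[/degD_ge2].
by move: (degD a) (degA a); lia.
Qed.

(** * The largest eigenvalue *)

Section Perron.
Variables (L : int) (x : G -> rat).
Hypothesis xpos : forall v, 0 < x v.
Hypothesis xeig : forall v, nbsum x v = L%:~R * x v.
Hypothesis gap : forall f, dot f x = 0 ->
  dot (nbsum f) f <= (L - 1)%:~R * dot f f.
Local Notation l := (L%:~R : rat).

Lemma le_eig a d : adj a d -> x d <= l * x a.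
Proof.
move=> ad; rewrite -xeig /nbsum (bigD1 d) //= lerDl.
by apply: sumr_ge0 => y _; apply: ltW.
Qed.

Lemma lt_eig a d d' : adj a d -> adj a d' -> d' != d -> x d < l * x a.
Proof.
move=> ad ad' dd; rewrite -xeig /nbsum (bigD1 d) //= (bigD1 d') ?ad' //=.
rewrite ltrDl ltr_wpDr //; apply: sumr_ge0 => y _; exact: ltW.
Qed.

Lemma eigenvalue_ge0 : 0 <= l.
Proof.
have [[/card_gt0P[v _] _] _] := treeG.
rewrite -(@pmulr_lge0 _ (x v)) ?xpos // -xeig.
by apply: sumr_ge0 => y _; apply: ltW.
Qed.

Lemma degree_le_eig (v : G) : #|nbrs v|%:R <= l ^+ 2.
Proof.
rewrite -(@ler_pM2r _ (x v)) ?xpos // expr2 -mulrA -xeig mulr_sumr.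
rewrite mulr_natl -sumr_const [leLHS](eq_bigl (fun y => adj v y)); last first.
  by move=> y; rewrite in_nbrs.
by apply: ler_sum => y vy; apply: le_eig; rewrite adj_sym.
Qed.

(** The end [d'] of the path is eliminated from [l * x a = x d + x d'] and [l * x d' = x a]. *)
Lemma pend_eig d a : d \in rim -> a \in pend -> adj d a ->
  (l ^+ 2 - 1) * x a = l * x d.
Proof.
move=> dR aP da; have [d' [d'd ad' d'D Na ld']] := pend_rim dR aP da.
have ad : adj a d by rewrite adj_sym.
have d'a : adj d' a by rewrite adj_sym.
have := xeig a; rewrite /nbsum (bigD1 d) //= (bigD1 d') ?ad' //= big1 ?addr0.
  have := xeig d'; rewrite /nbsum (bigD1 a) //= big1 ?addr0.
    by move=> E1 E2; rewrite expr2 mulrBl -mulrA -E2 mul1r mulrDr -E1; ring.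
  by move=> y /andP[d'y]; rewrite (leaf_nbr ld' d'a d'y) eqxx.
by move=> y /andP[/andP[/Na[]->]]; rewrite eqxx.
Qed.

Definition pendnum d := #|nbrs d :&: pend|.

Lemma rim_eig d : d \in rim ->
  (l ^+ 2 - 1 - (pendnum d)%:R) * (l * x d) =
  (l ^+ 2 - 1) * \sum_(a in core | adj d a) x a.
Proof.
move=> dR; have dD := rim_support dR.
have -> : \sum_(a in core | adj d a) x a = l * x d - \sum_(a in nbrs d :&: pend) x a.
  rewrite -xeig /nbsum [X in _ = X - _](bigID (mem pend)) /=.
  have -> : \sum_(a in nbrs d :&: pend) x a = \sum_(a | adj d a && (a \in pend)) x a.
    by apply: eq_bigl => a; rewrite in_setI in_nbrs.
  rewrite addrAC subrr add0r; apply: eq_bigl => a; rewrite in_setD in_setC andbC.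
  case da: (adj d a) => //=.
  by rewrite (support_independent da dD) !andbT.
rewrite [RHS]mulrBr [in RHS]mulr_sumr.
rewrite [X in _ = _ - X](eq_bigr (fun=> l * x d)) => [|a]; last first.
  by rewrite in_setI in_nbrs => /andP[da aP]; exact: pend_eig.
by rewrite sumr_const -/(pendnum d) -mulr_natl; ring.
Qed.

(* The Rayleigh quotient of [starvec d] exceeds [l - 1] as soon as [d] carries
   more than [(l - 1) ^+ 2] pendant paths. *)
Definition starvec d (y : G) : rat :=
  if y == d then l - 1 else if (y \in pend) && adj d y then 1 else 0.

Lemma pend_unique_rim d d' a : d \in rim -> d' \in rim -> a \in pend ->
  adj d a -> adj d' a -> d = d'.
Proof.
move=> dR d'R aP da d'a; have [e [ed ae eD Na le]] := pend_rim dR aP da.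
have ad' : adj a d' by rewrite adj_sym.
have [->//|E] := Na d' ad'.
by have := rim_nonleaf d'R aP d'a; rewrite E le.
Qed.

Lemma starvec_dot d (f : G -> rat) : d \in rim ->
  dot (starvec d) f = (l - 1) * f d + \sum_(a in nbrs d :&: pend) f a.
Proof.
move=> dR; rewrite /dot (bigD1 d) //= {1}/starvec eqxx; congr (_ + _).
rewrite [RHS]big_mkcond [RHS](bigD1 d) //=.
rewrite in_setI in_nbrs adj_irrefl add0r; apply: eq_bigr => y /negPf yd.
by rewrite /starvec yd in_setI in_nbrs andbC; case: ifP; rewrite ?mul1r ?mul0r.
Qed.

(** Stars at distinct rim vertices are joined by no edge: since [0 < pendnum e], [e] is not a leaf,
    hence not the end of a pendant path at [d]. *)
Lemma nbsum_starvec d e : d \in rim -> e \in rim -> (0 < pendnum e)%N ->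
  dot (starvec d) (nbsum (starvec e)) =
  if d == e then 2 * (l - 1) * (pendnum d)%:R else 0.
Proof.
move=> dR eR e0; rewrite starvec_dot //.
have offD y : y \in D -> y != e -> starvec e y = 0.
  move=> yD /negPf ye; rewrite /starvec ye; case: ifP => // /andP[/pendP[]].
  by rewrite yD.
have E1 : nbsum (starvec e) d = if d == e then (pendnum d)%:R else 0.
  have val y : adj d y -> starvec e y = ((d == e) && (y \in pend))%:R.
    move=> dy; rewrite /starvec; case: eqP => [ye|_].
      have := support_independent dy (rim_support dR).
      by rewrite ye (rim_support eR).
    have [E|de] := eqVneq d e; first by rewrite -E dy andbT; case: ifP.
    case: ifP => // /andP[yP ey].
    by rewrite (pend_unique_rim dR eR yP dy ey) eqxx in de.
  rewrite /nbsum (eq_bigr _ val); case: ifP => _; last by rewrite big1.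
  rewrite /pendnum -sum1_card natr_sum big_mkcond [RHS]big_mkcond /=.
  apply: eq_bigr => y _; rewrite in_setI in_nbrs.
  by case: adj; case: (y \in pend).
rewrite E1 (eq_bigr (fun=> if d == e then l - 1 else 0)) => [|a]; last first.
  rewrite in_setI in_nbrs => /andP[da aP].
  have [d' [d'd ad' d'D Na ld']] := pend_rim dR aP da.
  have ad : adj a d by rewrite adj_sym.
  rewrite /nbsum (bigD1 d) //= (bigD1 d') ?ad' //= big1 ?addr0; last first.
    by move=> y /andP[/andP[/Na[]->]]; rewrite eqxx.
  rewrite (offD d') ?addr0 //; last first.
    apply: contraTneq ld' => ->; have /card_gt0P[b] := e0.
    by rewrite in_setI in_nbrs => /andP[eb bP]; apply: rim_nonleaf eR bP eb.
  case: (eqVneq d e) => [->|de]; first by rewrite /starvec eqxx.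
  exact: offD (rim_support dR) de.
rewrite sumr_const -/(pendnum d); case: eqP => _; last by rewrite mul0rn mulr0 addr0.
by rewrite -mulr_natl; ring.
Qed.

Lemma starvec_dot_starvec d e : d \in rim -> e \in rim ->
  dot (starvec d) (starvec e) =
  if d == e then (l - 1) ^+ 2 + (pendnum d)%:R else 0.
Proof.
move=> dR eR; rewrite starvec_dot //.
rewrite (eq_bigr (fun=> if d == e then 1 else 0)) => [|a]; last first.
  rewrite in_setI in_nbrs => /andP[da aP]; rewrite /starvec aP /=.
  have [aD _ _] := pendP aP.
  case: eqP => [ae|_]; first by rewrite ae (rim_support eR) in aD.
  have [<-|de] := eqVneq d e; first by rewrite da.
  by case: ifP => // ea; rewrite (pend_unique_rim dR eR aP da ea) eqxx in de.
rewrite sumr_const -/(pendnum d); case: eqP => [<-|/eqP de].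
  by rewrite /starvec eqxx -expr2 -mulr_natl mulr1.
rewrite mul0rn addr0 /starvec (negPf de); case: ifP => [/andP[/pendP[]]|].
  by rewrite (rim_support dR).
by rewrite mulr0.
Qed.

(** A star with [m] pendant paths contributes a positive multiple of [(l - 1) * (m - (l - 1) ^+ 2)]
    to [<nbsum z, z> - (l - 1) * <z, z>]. If both numbers were too large, the combination [z] of the
    two stars orthogonal to [x] would violate the gap. *)
Lemma pendnum_le (v w : G) : 1 < l -> v \in rim -> w \in rim -> v != w ->
  (pendnum w <= pendnum v)%N -> (pendnum w)%:R <= (l - 1) ^+ 2.
Proof.
move=> l1 vR wR vw mwv; rewrite leNgt; apply/negP => mw.
have mw0 : (0 < pendnum w)%N.
  by rewrite -(ltr_nat rat); apply: le_lt_trans mw; apply: sqr_ge0.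
have mv0 := leq_trans mw0 mwv.
have mv : (l - 1) ^+ 2 < (pendnum v)%:R.
  by apply: lt_le_trans mw _; rewrite ler_nat.
pose al := dot (starvec w) x; pose be := dot (starvec v) x.
pose z y := al * starvec v y + (- be) * starvec w y.
have zx : dot z x = 0 by rewrite /z dotDl !dotZl /al /be; ring.
have := gap zx.
have Ez : nbsum z =1 fun y => al * nbsum (starvec v) y + (- be) * nbsum (starvec w) y.
  by move=> y; rewrite /z nbsumD !nbsumZ.
rewrite (eq_dotl _ Ez) dotC /z !(dotDl, dotDr, dotZl, dotZr).
rewrite !nbsum_starvec // !starvec_dot_starvec // !eqxx (eq_sym w) (negPf vw).
have al0 : 0 < al.
  rewrite /al starvec_dot // ltr_wpDr ?mulr_gt0 ?subr_gt0 //.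
  by apply: sumr_ge0 => y _; apply: ltW.
rewrite intrB; set mV := (pendnum v)%:R in mv *; set mW := (pendnum w)%:R in mw *.
rewrite -subr_ge0 [X in 0 <= X](_ : _ =
  - ((l - 1) * (al ^+ 2 * (mV - (l - 1) ^+ 2)
      + be ^+ 2 * (mW - (l - 1) ^+ 2)))); last by ring.
rewrite oppr_ge0 leNgt mulr_gt0 ?subr_gt0 // ltr_wpDr //.
  by rewrite mulr_ge0 ?sqr_ge0 // subr_ge0 ltW.
by rewrite mulr_gt0 ?exprn_gt0 // subr_gt0.
Qed.

Lemma eigenvalue_lt (K k : nat) : (#|core| <= K)%N ->
  (forall a, a \notin D -> #|nbrs a| <= k)%N ->
  l < (K * k + K * (K * k) + 2)%:R.
Proof.
move=> coreK nbrk; rewrite ltNge; apply/negP => lK.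
have l1 : 1 < l by apply: lt_le_trans lK; rewrite (ltr_nat _ 1); lia.
have l0 : 0 < l by lra.
have l2 : 0 < l ^+ 2 - 1 by nra.
have /set0Pn[r0 r0R] := rim_neq0.
have [v vR vmax] : exists2 v, v \in rim &
    {in rim, forall w : G, (pendnum w <= pendnum v)%N}.
  by case: (arg_maxnP pendnum r0R) => v vR vm; exists v.
have xge y : 0 <= x y by exact: ltW.
pose S := \sum_(a in core) x a.
have S0 : 0 <= S by apply: sumr_ge0.
have xS a : a \in core -> x a <= S.
  by move=> aC; rewrite /S (bigD1 a) //= lerDl sumr_ge0.
pose T d := \sum_(a in core | adj d a) x a.
have TS d : T d <= S.
  rewrite /T /S big_mkcondr; apply: ler_sum => a _; case: ifP => //.
(* By [pendnum_le], the factor [l ^+ 2 - 1 - m] in [rim_eig] is at least [2 * (l - 1)]. *)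
have rimS (w : G) : w \in rim -> w != v -> x w <= S.
  move=> wR wv; have := rim_eig wR; rewrite -/(T w) => E.
  have mw : (pendnum w)%:R <= (l - 1) ^+ 2.
    by apply: (@pendnum_le v) => //; [rewrite eq_sym | apply: vmax].
  have : 2 * (l - 1) * (l * x w) <= (l ^+ 2 - 1) * S.
    apply: le_trans (_ : (l ^+ 2 - 1) * T w <= _); last by rewrite ler_pM2l.
    rewrite -E ler_wpM2r ?mulr_ge0 ?(ltW l0) //.
    by move: mw; set m := _%:R; rewrite !expr2; lra.
  rewrite (_ : l ^+ 2 - 1 = (l - 1) * (l + 1)); last by ring.
  rewrite -mulrA (mulrC 2) -!mulrA ler_pM2l; last by rewrite subr_gt0.
  move=> H; have : (l + 1) * S <= 2 * l * S.
    by rewrite ler_wpM2r //; lra.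
  move=> H2; have : l * x w <= l * S by lra.
  by rewrite ler_pM2l.
(* Each of the at most [k] neighbours of [a] lies in the rim or the core and, apart from [v],
   carries at most [S]. *)
have coreS a : a \in core -> l * x a <= (adj v a)%:R * x v + k%:R * S.
  move=> aC; rewrite -xeig /nbsum.
  apply: le_trans (_ : \sum_(y in nbrs a) ((y == v)%:R * x v + S) <= _).
    rewrite [leRHS](eq_bigl (fun y => adj a y)); last by move=> y; rewrite in_nbrs.
    apply: ler_sum => y ay; have [->|yv] := eqVneq y v.
      by rewrite mul1r lerDl.
    rewrite mul0r add0r; have [yR|yC] := core_nbr aC ay; first exact: rimS.
    exact: xS.
  rewrite big_split /= sumr_const; apply: lerD.
    rewrite -mulr_suml ler_wpM2r // (bigID (pred1 v)) /= [X in _ + X]big1 ?addr0.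
      case va: (adj v a).
        rewrite (bigD1 v) /=; last by rewrite in_nbrs adj_sym va eqxx.
        rewrite eqxx big1 ?addr0 // => y /andP[/andP[_ /eqP->]]; by rewrite eqxx.
      rewrite big1 // => y /andP[ay /eqP yv]; move: ay.
      by rewrite yv in_nbrs adj_sym va.
    by move=> y /andP[_ /negPf->].
  by rewrite -[S *+ _]mulr_natl ler_wpM2r // ler_nat nbrk // core_off_support.
pose Nv := [set a in core | adj v a]; pose d' : rat := #|Nv|%:R.
have NvE a : (a \in Nv) = (a \in core) && adj v a by rewrite in_set.
have d'K : d' <= K%:R.
  rewrite ler_nat; apply: leq_trans coreK.
  by apply/subset_leq_card/subsetP => a; rewrite NvE => /andP[].
have d'0 : 0 <= d' by rewrite ler0n.
have sumadj : \sum_(a in core) (adj v a)%:R = d'.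
  rewrite /d' -sum1_card natr_sum big_mkcond [RHS]big_mkcond /=.
  by apply: eq_bigr => a _; rewrite NvE; case: (a \in core); case: adj.
pose c : rat := (K * k)%:R.
have c0 : 0 <= c by rewrite ler0n.
have lS : l * S <= d' * x v + c * S.
  rewrite /S mulr_sumr.
  apply: le_trans (_ : \sum_(a in core) ((adj v a)%:R * x v + k%:R * S) <= _).
    by apply: ler_sum => a aC; apply: coreS.
  rewrite big_split /= -mulr_suml sumadj lerD2l sumr_const -[_ * S *+ _]mulr_natl mulrA.
  by rewrite ler_wpM2r // -natrM ler_nat leq_mul2r coreK orbT.
have lK' : c + K%:R * c + 2 <= l by rewrite /c -!natrM -!natrD.
have K0 : 0 <= K%:R :> rat by rewrite ler0n.
(* Concentration of [x] near [v]. The constant in the bound on [l] is chosen here: it gives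
   [(K * c + 2) * S <= K * x v], hence [c * S < x v]. *)
have kS : d' * (k%:R * S) < x v.
  have dk : d' * k%:R <= c by rewrite /c natrM ler_wpM2r.
  have H1 : (l - c) * S <= K%:R * x v.
    apply: le_trans (_ : d' * x v <= _); last by rewrite ler_wpM2r.
    by rewrite mulrBl; lra.
  have H2 : (K%:R * c + 2) * S <= K%:R * x v.
    by apply: le_trans H1; rewrite ler_wpM2r //; lra.
  have [S1|S1] := eqVneq S 0; first by rewrite S1 !mulr0.
  have S2 : 0 < S by rewrite lt_def S1.
  have cS : c * S < x v.
    have [K1|K1] := eqVneq K 0%N; first by rewrite /c K1 mul0n mul0r.
    have K2 : 0 < K%:R :> rat by rewrite ltr0n lt0n.
    rewrite -(@ltr_pM2l _ K%:R) //; apply: lt_le_trans H2.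
    by rewrite mulrA ltr_pM2r //; lra.
  by rewrite mulrA; apply: le_lt_trans cS; rewrite ler_wpM2r.
have Ev := rim_eig vR; rewrite -/(T v) in Ev.
set m : rat := (pendnum v)%:R in Ev.
have TvE : T v = \sum_(a in Nv) x a by apply: eq_bigl => a; rewrite NvE.
have upper : l * T v < (d' + 1) * x v.
  rewrite TvE mulr_sumr.
  apply: le_lt_trans (_ : \sum_(a in Nv) (x v + k%:R * S) < _).
    apply: ler_sum => a; rewrite NvE => /andP[aC va].
    by have := coreS a aC; rewrite va mul1r.
  by rewrite sumr_const -[(_ + _) *+ _]mulr_natl -/d' mulrDr mulrDl mul1r ltrD2l.
(* With [y] a second neighbour of [a] in [D], the weak inequality follows from
   [x v + x y <= l * x a] and [x a <= l * x y]. The first is strict if [a] is bad, by a third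
   neighbour; the second if [a] is good, as [y] is then no leaf. *)
have strict a : a \in Nv -> l * x v < (l ^+ 2 - 1) * x a.
  rewrite NvE => /andP[aC va]; have aD := core_off_support aC.
  have aP : a \notin pend by move: aC; rewrite in_setD => /andP[].
  have av : adj a v by rewrite adj_sym.
  have [y yv /andP[yD ay]] := support_second_neighbour (rim_support vR) av.
  have ya : adj y a by rewrite adj_sym.
  have le1 : x v + x y <= l * x a.
    rewrite -xeig /nbsum (bigD1 v) //= (bigD1 y) ?ay //= addrA lerDl.
    by apply: sumr_ge0 => u _.
  have le2 : x a <= l * x y := le_eig ya.
  suff : x v + x y < l * x a \/ x a < l * x y.
    by case=> H; rewrite expr2 mulrBl mul1r -mulrA; nra.
  have [ab|ab] := boolP (a \in bad); last first.
    right; have [|b ba yb] := nonleaf_other_nbr ya; last exact: lt_eig ya yb ba.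
    apply: contra aP => ly; rewrite inE in_setC aD ab.
    by apply/existsP; exists y; rewrite ay.
  left; have [u [uv uy au]] : exists u, [/\ u != v, u != y & adj a u].
    case: (pickP [pred u | [&& u != v, u != y & adj a u]]) => [u /and3P[]|no].
      by exists u.
    have sub : nbrs a \subset [set v; y].
      apply/subsetP => u; rewrite in_nbrs !inE => au.
      by apply: contraFT (no u); rewrite negb_or /= au => /andP[-> ->].
    have := subset_leq_card sub; rewrite cards2 eq_sym yv leqNgt.
    by rewrite bad_degree.
  rewrite -xeig /nbsum (bigD1 v) //= (bigD1 y) ?ay //= addrA ltrDl.
  rewrite (bigD1 u) /=; last by rewrite au uv.
  by rewrite ltr_wpDr //; apply: sumr_ge0.
have [b bC vb] := rim_core vR.
have bN : b \in Nv by rewrite NvE bC.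
have lower : d' * (l * x v) < (l ^+ 2 - 1) * T v.
  rewrite TvE mulr_sumr /d' mulr_natl -sumr_const.
  rewrite (bigD1 b) //= [ltRHS](bigD1 b) //=.
  apply: ltr_leD; first exact: strict.
  by apply: ler_sum => a /andP[aN _]; apply/ltW/strict.
have lx : 0 < l * x v by rewrite mulr_gt0.
have H1 : d' < l ^+ 2 - 1 - m by rewrite -(@ltr_pM2r _ (l * x v)) // Ev.
have H2 : l ^+ 2 - 1 - m < d' + 1.
  rewrite -(@ltr_pM2r _ (l * x v)) // Ev.
  have : l * ((l ^+ 2 - 1) * T v) < l * ((d' + 1) * (l * x v)).
    rewrite mulrCA (_ : l * ((d' + 1) * (l * x v)) =
      l ^+ 2 * ((d' + 1) * x v)); last by ring.
    apply: le_lt_trans (_ : l ^+ 2 * (l * T v) < _).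
      rewrite ler_wpM2r //; last by lra.
      by rewrite mulr_ge0 ?(ltW l0) //; apply: sumr_ge0.
    by rewrite ltr_pM2l // exprn_gt0.
  by rewrite ltr_pM2l.
(* The integer [z] would lie strictly between [q] and [q + 1]. *)
pose z : int := L * L - 1 - (pendnum v)%:Z; pose q : int := #|Nv|%:Z.
have Ez : z%:~R = l ^+ 2 - 1 - m by rewrite /z !intrB intrM expr2.
have qz : q < z by rewrite -(ltr_int rat) Ez.
have : z < q + 1 by rewrite -(ltr_int rat) Ez intrD.
by rewrite ltzD1 leNgt qz.
Qed.

End Perron.

(** * An explicit bound on the number of vertices *)

Definition core_bound (h : nat) : nat :=
  (2 * h + 2 * h * (2 * h + 2))%N.

Definition eigenvalue_bound (h : nat) : nat :=
  (core_bound h * (2 * h + 2) + core_bound h * (core_bound h * (2 * h + 2)) + 2)%N.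

(** This is [2 * #|~: D| + h], with [~: D] split into [core] and [pend]: there are at most
    [core_bound h * (2 * h + 2)] rim vertices, each of degree at most the square of the largest
    eigenvalue. *)
Definition card_bound (h : nat) : nat :=
  (2 * (core_bound h + core_bound h * (2 * h + 2) *
    (eigenvalue_bound h * eigenvalue_bound h)) + h)%N.

Lemma card_tree_le : (#|G| <= card_bound (nullity G))%N.
Proof.
have [conG _] := treeG.
set h := nullity G; rewrite /card_bound; set B := eigenvalue_bound h.
set K := core_bound h; set k := (2 * h + 2)%N.
have [L [x [xpos xeig gap]]] := perron conG intG.
have coreK : (#|core| <= K)%N := card_core.
have lB := eigenvalue_lt xpos xeig gap coreK deg_le.
have l0 := eigenvalue_ge0 xpos xeig.
have degB (v : G) : (#|nbrs v| <= B * B)%N.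
  rewrite -(ler_nat rat); apply: le_trans (degree_le_eig xpos xeig v) _.
  by rewrite natrM expr2 ler_pM // ltW.
have rimK : (#|rim| <= K * k)%N.
  apply: leq_trans (_ : #|core| * k <= _)%N; last by rewrite leq_mul2r coreK orbT.
  apply: card_covered => [d /rim_core[a aC da]|a /core_off_support/deg_le //].
  by exists a; rewrite // adj_sym.
have pendK : (#|pend| <= K * k * (B * B))%N.
  apply: leq_trans (_ : #|rim| * (B * B) <= _)%N; last by rewrite leq_mul2r rimK orbT.
  apply: card_covered => [a /pend_adj_rim[d dR ad]|d _ //].
  by exists d; rewrite // adj_sym.
apply: leq_trans card_support_complement _; rewrite leq_add2r leq_mul2l /=.
rewrite -(cardsID pend) addnC; apply: leq_add; first exact: coreK.
by apply: leq_trans pendK; apply/subset_leq_card/subsetIr.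
Qed.

End KernelSupport.

(** * Finiteness *)

Section GraphsOfBoundedOrder.
Variable N : nat.

Definition relcode : finType :=
  {m : 'I_N.+1 & {ffun 'I_m * 'I_m -> bool} : finType}.

(** Symmetrised and without diagonal, so that every code yields a simple graph. *)
Definition code_adj (c : relcode) : rel 'I_(tag c) :=
  fun x y => (x != y) && (tagged c (x, y) || tagged c (y, x)).

Lemma code_adj_sym c : symmetric (@code_adj c).
Proof. by move=> x y; rewrite /code_adj eq_sym orbC. Qed.

Lemma code_adj_irrefl c : irreflexive (@code_adj c).
Proof. by move=> x; rewrite /code_adj eqxx. Qed.

Definition graph_of_code (c : relcode) : sgraph :=
  SGraph (@code_adj_sym c) (@code_adj_irrefl c).

Lemma graph_has_code (G : sgraph) : (#|G| <= N)%N ->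
  exists c : relcode, isomorphic G (graph_of_code c).
Proof.
rewrite -ltnS => leN; pose m := Ordinal leN.
pose r : {ffun 'I_m * 'I_m -> bool} :=
  [ffun p : 'I_m * 'I_m => adj (enum_val p.1 : G) (enum_val p.2)].
pose c : relcode := Tagged (fun m : 'I_N.+1 => {ffun 'I_m * 'I_m -> bool} : finType) r.
exists c, (enum_rank : G -> 'I_#|G|).
  by exists enum_val; [exact: enum_rankK | exact: enum_valK].
move=> x y; rewrite /= /code_adj /= !ffunE /= !enum_rankK (adj_sym y) orbb.
rewrite (inj_eq enum_rank_inj).
by case: eqP => // ->; rewrite adj_irrefl.
Qed.

End GraphsOfBoundedOrder.

Lemma In_map (A : eqType) (B : Type) (f : A -> B) (s : seq A) (a : A) :
  a \in s -> List.In (f a) (map f s).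
Proof.
by elim: s => //= b s IH; rewrite inE => /orP[/eqP->|/IH]; [left | right].
Qed.

Lemma finitely_many_of_card_le (P : sgraph -> Prop) (N : nat) :
  (forall G, P G -> #|G| <= N)%N -> finitely_many_up_to_iso P.
Proof.
move=> PN; exists (map (@graph_of_code N) (enum (relcode N))) => G /PN.
case/graph_has_code=> c isoG; exists (graph_of_code c) => //.
by apply: In_map; rewrite mem_enum.
Qed.

Theorem theorem3p6 (h : nat) (h_ge2 : (2 <= h)%N) :
  finitely_many_up_to_iso
    (fun G : sgraph => [/\ is_tree G, integral_graph G & nullity G = h]).
Proof.
apply: (@finitely_many_of_card_le _ (card_bound h)) => G [treeG intG nulG].
by rewrite -nulG; apply: card_tree_le; rewrite // nulG.
Qed.
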